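(* Let $\mathbf{E}=(\lambda,\mu,\mathbf{d}',\mathbf{v}',\mathbf{H})\in\mathbb{E}\mathrm{la}$ and $\mathbf{F}=(\ell,m,\mathbf{e}',\mathbf{w}',\mathbf{K})\in\mathbb{E}\mathrm{la}$ be two elasticity-like fourth-order tensors, given together with their harmonic decompositions, and let $\mathbf{d}_2(\mathbf{H})$ and $\mathbf{d}_2(\mathbf{K})$ be the second-order tensors with components $$(\mathbf{d}_2(\mathbf{H}))_{ij}=H_{ipqr}H_{pqrj},\qquad (\mathbf{d}_2(\mathbf{K}))_{ij}=K_{ipqr}K_{pqrj}.$$ Then the pair $(\mathbf{E},\mathbf{F})$ is cubic if and only if $$\mathbf{d}'=\mathbf{v}'=\mathbf{e}'=\mathbf{w}'=0$$ and either (a) $\mathbf{d}_2(\mathbf{H})'=0$ and $\mathbf{H}=k\mathbf{K}\neq 0$ for some $k\in\mathbb{R}$, or (b) $\mathbf{d}_2(\mathbf{K})'=0$ and $\mathbf{K}=k\mathbf{H}\neq 0$ for some $k\in\mathbb{R}$.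
   Context: All tensors are real tensors on Euclidean $\mathbb{R}^3$, written in components in orthonormal bases; repeated indices are summed from 1 to 3. $\mathbf{1}$ is the identity second-order tensor (components $\delta_{ij}$). $\mathbb{E}\mathrm{la}$ is the 21-dimensional space of fourth-order tensors $\mathbf{E}$ with $E_{ijkl}=E_{jikl}=E_{ijlk}=E_{klij}$. The group $\mathrm{SO}(3)$ acts on it by $(Q\star\mathbf{E})_{ijkl}=Q_{ip}Q_{jq}Q_{kr}Q_{ls}E_{pqrs}$, and the symmetry group of $\mathbf{E}$ is $G_{\mathbf{E}}=\{Q\in\mathrm{SO}(3): Q\star\mathbf{E}=\mathbf{E}\}$. Cubic tensors and pairs. A tensor $\mathbf{E}\in\mathbb{E}\mathrm{la}$ is cubic if $G_{\mathbf{E}}$ is conjugate in $\mathrm{SO}(3)$ to the orientation-preserving octahedral group $\mathbb{O}$ (of order 24, the rotations preserving a cube). Equivalently, there is an orthonormal basis (a cubic basis of $\mathbf{E}$) in which $E_{1111}=E_{2222}=E_{3333}$, $E_{1122}=E_{1133}=E_{2233}$, $E_{1212}=E_{1313}=E_{2323}$, all components not obtained from these by the index symmetries vanish, and $E_{1111}-E_{1122}-2E_{1212}\neq 0$. A pair $(\mathbf{E},\mathbf{F})\in\mathbb{E}\mathrm{la}\times\mathbb{E}\mathrm{la}$ is cubic if both $\mathbf{E}$ and $\mathbf{F}$ are cubic and they share the same cubic axes, i.e. there is a common orthonormal basis that is a cubic basis of both. Notation. For a second-order tensor $\mathbf{a}$, $\mathbf{a}'=\mathbf{a}-\frac13(\operatorname{tr}\mathbf{a})\mathbf{1}$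 is its deviatoric part. For a tensor $\mathbf{T}$, $\mathbf{T}^s$ is its total symmetrization; for $\mathbf{E}\in\mathbb{E}\mathrm{la}$, $(\mathbf{E}^s)_{ijkl}=\frac13(E_{ijkl}+E_{ikjl}+E_{iljk})$. For totally symmetric tensors $\mathbf{S},\mathbf{T}$, $\mathbf{S}\odot\mathbf{T}=(\mathbf{S}\otimes\mathbf{T})^s$. Harmonic decomposition. For $\mathbf{E}\in\mathbb{E}\mathrm{la}$ set $\mathbf{d}=\operatorname{tr}_{12}\mathbf{E}$ (components $d_{kl}=E_{iikl}$), $\mathbf{v}=\operatorname{tr}_{13}\mathbf{E}$ (components $v_{jl}=E_{ijil}$), $\lambda=\frac1{15}(2\operatorname{tr}\mathbf{d}-\operatorname{tr}\mathbf{v})$, $\mu=\frac1{30}(3\operatorname{tr}\mathbf{v}-\operatorname{tr}\mathbf{d})$ and $$\mathbf{H}=\mathbf{E}^s-(2\mu+\lambda)\,\mathbf{1}\odot\mathbf{1}-\tfrac27\,\mathbf{1}\odot(\mathbf{d}'+2\mathbf{v}'),$$ which is a totally symmetric traceless (harmonic) fourth-order tensor. The notation $\mathbf{E}=(\lambda,\mu,\mathbf{d}',\mathbf{v}',\mathbf{H})$ refers to these quantities. Likewise, $\mathbf{F}=(\ell,m,\mathbf{e}',\mathbf{w}',\mathbf{K})$ denotes the quantities obtained by the same formulas from $\mathbf{F}$, with $\mathbf{e}=\operatorname{tr}_{12}\mathbf{F}$, $\mathbf{w}=\operatorname{tr}_{13}\mathbf{F}$, and $\ell,m,\mathbf{K}$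 in place of $\lambda,\mu,\mathbf{H}$. *)

(* Defs.v *)
From HB Require Import structures.
From mathcomp Require Import all_boot all_order all_algebra all_fingroup.
From mathcomp Require Import classical_sets reals.
From mathcomp Require Import ring.

Set Implicit Arguments.
Unset Strict Implicit.
Unset Printing Implicit Defensive.

Import Order.TTheory GRing.Theory Num.Theory.
Local Open Scope ring_scope.
Local Open Scope classical_set_scope.

(* Components of tensors in the canonical basis of R^3; the indices
   1, 2, 3 are the ordinals 0, 1, 2 of 'I_3.  Second-order tensors are
   matrices 'M[R]_3.  The codomain R^o provides the R-module structure. *)
Notation tensor4 R := {ffun 'I_3 * 'I_3 * 'I_3 * 'I_3 -> R^o}.

Lemma sum_lift_perm (V : zmodType) n (F : 'S_n.+1 -> V) :
  \sum_s F s = \sum_(i < n.+1) \sum_(s : 'S_n) F (lift_perm ord0 i s).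
Proof.
rewrite (partition_big (fun s : 'S_n.+1 => s ord0) xpredT) //=.
apply: eq_bigr => i _; rewrite (reindex (lift_perm ord0 i)); last first.
  pose ulsf k (s : 'S_n.+1) j := odflt j (unlift (s k) (s (lift k j))).
  have ulsfK (s : 'S_n.+1) j : lift (s ord0) (ulsf ord0 s j) = s (lift ord0 j).
    rewrite /ulsf; have:= neq_lift ord0 j.
    by rewrite -(can_eq (permK s)) => /unlift_some[] ? ? ->.
  have inj_ulsf s : injective (ulsf ord0 s).
    move=> j j' /(congr1 (lift (s ord0))); rewrite !ulsfK => /perm_inj.
    exact: lift_inj.
  exists (fun s => perm (inj_ulsf s)) => [s _ | s].
    by apply/permP => j; rewrite permE /ulsf lift_perm_lift lift_perm_id liftK.
  rewrite inE /= => /eqP si; apply/permP => j.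
  case: (unliftP ord0 j) => [j' ->|->]; rewrite ?lift_perm_id ?si //.
  by rewrite lift_perm_lift -si permE ulsfK.
by apply: eq_bigl => s; rewrite lift_perm_id eqxx.
Qed.

Section Tensors.
Variable R : realType.
Implicit Types (A B Q P : 'M[R]_3) (E T H : tensor4 R).

Definition Ela : set (tensor4 R) := [set E | forall i j k l,
  [/\ E (i, j, k, l) = E (j, i, k, l),
      E (i, j, k, l) = E (i, j, l, k) &
      E (i, j, k, l) = E (k, l, i, j)]].

Definition O3 : set 'M[R]_3 := [set Q | Q *m Q^T = 1%:M].

Definition SO3 : set 'M[R]_3 := [set Q | O3 Q /\ \det Q = 1].

(* For Q in O3, these are also the components of E in the orthonormal basis
   formed by the rows of Q. *)
Definition star Q E : tensor4 R := [ffun x => let: (i, j, k, l) := x in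
  \sum_(p < 3) \sum_(q < 3) \sum_(r < 3) \sum_(s < 3)
    Q i p * Q j q * Q k r * Q l s * E (p, q, r, s)].

Definition symgroup E : set 'M[R]_3 := [set Q | SO3 Q /\ star Q E = E].

Definition cube : set 'cV[R]_3 := [set x | forall i, `|x i 0| <= 1].

Definition octahedral : set 'M[R]_3 :=
  [set Q | SO3 Q /\ [set Q *m x | x in cube] = cube].

Definition cubic E : Prop := Ela E /\ exists2 g, SO3 g &
  symgroup E = [set g *m Q *m invmx g | Q in octahedral].

(* The index quadruples reached from 1111, 1122, 1212 and their analogues by
   the symmetries of Ela are those whose indices pair up in one of the three
   possible ways. *)
Definition cubic_components E : Prop :=
  let i1 : 'I_3 := inord 0 in
  let i2 : 'I_3 := inord 1 in
  let i3 : 'I_3 := inord 2 in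
  [/\ E (i1, i1, i1, i1) = E (i2, i2, i2, i2) /\
      E (i2, i2, i2, i2) = E (i3, i3, i3, i3),
      E (i1, i1, i2, i2) = E (i1, i1, i3, i3) /\
      E (i1, i1, i3, i3) = E (i2, i2, i3, i3),
      E (i1, i2, i1, i2) = E (i1, i3, i1, i3) /\
      E (i1, i3, i1, i3) = E (i2, i3, i2, i3),
      forall i j k l,
        ~~ [|| (i == j) && (k == l), (i == k) && (j == l)
             | (i == l) && (j == k)] -> E (i, j, k, l) = 0 &
      E (i1, i1, i1, i1) - E (i1, i1, i2, i2) - 2 * E (i1, i2, i1, i2) != 0].

Definition cubic_basis E P : Prop := O3 P /\ cubic_components (star P E).

Definition cubic_pair E F : Prop :=
  [/\ cubic E, cubic F & exists P, cubic_basis E P /\ cubic_basis F P].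

Definition dev A : 'M[R]_3 := A - (3^-1 * \tr A) *: 1%:M.

Definition tensor_prod A B : tensor4 R :=
  [ffun x => let: (i, j, k, l) := x in A i j * B k l].

Definition total_sym T : tensor4 R := [ffun x => let: (i, j, k, l) := x in
  let t := [tuple i; j; k; l] in
  (4`!)%:R^-1 * \sum_(s : 'S_4)
    T (tnth t (s (inord 0)), tnth t (s (inord 1)),
       tnth t (s (inord 2)), tnth t (s (inord 3)))].

Lemma sum_S4 (G : 'I_4 -> 'I_4 -> 'I_4 -> 'I_4 -> R) :
  \sum_(s : 'S_4) G (s (inord 0)) (s (inord 1)) (s (inord 2)) (s (inord 3)) =
  \sum_(a < 4) \sum_(b < 3) \sum_(c < 2)
    G a (lift a b) (lift a (lift b c)) (lift a (lift b (lift c ord0))).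
Proof.
have -> : inord 0 = ord0 :> 'I_4 by apply: val_inj; rewrite /= inordK.
have -> : inord 1 = lift ord0 ord0 :> 'I_4 by apply: val_inj; rewrite /= inordK.
have -> : inord 2 = lift ord0 (lift ord0 ord0) :> 'I_4
  by apply: val_inj; rewrite /= inordK.
have -> : inord 3 = lift ord0 (lift ord0 (lift ord0 ord0)) :> 'I_4
  by apply: val_inj; rewrite /= inordK.
rewrite sum_lift_perm; apply: eq_bigr => a _.
rewrite sum_lift_perm; apply: eq_bigr => b _.
rewrite sum_lift_perm; apply: eq_bigr => c _.
rewrite sum_lift_perm big_ord1.
under eq_bigr do rewrite !(lift_perm_lift, lift_perm_id).
by rewrite sumr_const card_Sn mulr1n (ord1 0).
Qed.

(* On Ela the 24 terms reduce to the usual three-term formula for E^s. *)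
Lemma total_sym_Ela (E : tensor4 R) i j k l : Ela E ->
  total_sym E (i, j, k, l) =
  3^-1 * (E (i, j, k, l) + E (i, k, j, l) + E (i, l, j, k)).
Proof.
move=> hE; rewrite /total_sym ffunE.
rewrite (sum_S4 (fun a b c d => E (tnth _ a, tnth _ b, tnth _ c, tnth _ d))).
rewrite !big_ord_recl !big_ord0 !(tnth_nth i) /=.
have h1 a b c d : E (a, b, c, d) = E (b, a, c, d) by case: (hE a b c d).
have h2 a b c d : E (a, b, c, d) = E (a, b, d, c) by case: (hE a b c d).
have h3 a b c d : E (a, b, c, d) = E (c, d, a, b) by case: (hE a b c d).
have f : 4`!%:R = 24 :> R by [].
rewrite f /bump /=.
have N a b c d : [/\ E (a, b, d, c) = E (a, b, c, d), E (b, a, c, d) = E (a, b, c, d),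
 E (b, a, d, c) = E (a, b, c, d) &
 [/\ E (c, d, a, b) = E (a, b, c, d),
 E (c, d, b, a) = E (a, b, c, d),
 E (d, c, a, b) = E (a, b, c, d) & E (d, c, b, a) = E (a, b, c, d)]].
  split; last split.
  - by rewrite h2.
  - by rewrite h1.
  - by rewrite h1 h2.
  - by rewrite h3.
  - by rewrite h3 h1.
  - by rewrite h3 h2.
  - by rewrite h3 h1 h2.
have [-> -> -> [-> -> -> ->]] := N i j k l.
have [-> -> -> [-> -> -> ->]] := N i k j l.
have [-> -> -> [-> -> -> ->]] := N i l j k.
by field.
Qed.

Definition sym_prod A B : tensor4 R := total_sym (tensor_prod A B).

Definition tr12 E : 'M[R]_3 := \matrix_(k, l) \sum_(i < 3) E (i, i, k, l).

Definition tr13 E : 'M[R]_3 := \matrix_(j, l) \sum_(i < 3) E (i, j, i, l).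

Definition lame_lambda E : R := 15^-1 * (2 * \tr (tr12 E) - \tr (tr13 E)).

Definition lame_mu E : R := 30^-1 * (3 * \tr (tr13 E) - \tr (tr12 E)).

Definition harm E : tensor4 R :=
  total_sym E
  - (2 * lame_mu E + lame_lambda E) *: sym_prod 1%:M 1%:M
  - (2 / 7) *: sym_prod 1%:M (dev (tr12 E) + 2 *: dev (tr13 E)).

Definition d2 H : 'M[R]_3 := \matrix_(i, j)
  \sum_(p < 3) \sum_(q < 3) \sum_(r < 3) H (i, p, q, r) * H (p, q, r, j).

End Tensors.

(* Main.v *)
Require Import Defs.
From HB Require Import structures.
From mathcomp Require Import all_boot all_order all_algebra all_fingroup.
From mathcomp Require Import classical_sets reals.
From mathcomp Require Import boolp topology normedtype derive.
From mathcomp Require Import ring lra.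

(** Why the theorem holds.

    The part that is not linear algebra is a classification: a harmonic tensor H
    for which d2(H) is isotropic is a multiple of the harmonic part of
    e1^4 + e2^4 + e3^4 for some orthonormal basis (e1, e2, e3); this is
    [isotropic_d2_cubic_harmonic].  View H as the quartic form h(v) = H(v,v,v,v),
    let |h| attain its maximum over the unit sphere at v0 ([quartic_max]), change
    the sign of H if necessary so that h(v0) is nonnegative, and take v0 as third
    basis vector, the pole.  Split h into its weights under the rotations about the
    pole: a real amplitude a0 in weight 0 and complex amplitudes a1, ..., a4.

    - The pole is a critical point of h on the sphere, so a1 = 0.
    - The deviator of d2(H) has components of weight 2, 1 and 0.  With a suitable
      normalisation their vanishing reads (15/8) a0 a2 = - a4 conj(a2), then
      5 a3 conj(a2) + 4 a4 conj(a3) = 0, and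
      2 |a4|^2 + |a3|^2 - |a2|^2 = (25/32) a0^2.
    - Averaging h over the quarter turns of an equatorial square bounds the
      modulus of a4 by (5/8) a0.  If a2 were nonzero, the weight 2 equation would
      give |a4| = (15/8) a0, which is too large.  So a2 = 0, and then
      a4 conj(a3) = 0.
    - If a4 = 0, the pole is a threefold axis of a cube, where |h| is only two
      thirds of its value on the fourfold axes: the pole would not be a maximum.
      So a3 = 0 and |a4| = (5/8) a0, and turning the basis about the pole by a
      quarter of the argument of a4 brings h into cubic form.

    These steps are [harmonic_quartic_maximal_at_pole] for the inequalities and
    [harmonic_maximal_at_pole] for the passage from tensors to amplitudes.

    The rest relates this to the definition of cubic tensors.  When the deviators
    of the two traces of E vanish, E is the sum of an isotropic tensor and of its
    harmonic part ([harm_decomposition]), so E is an isotropic tensor plus a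
    multiple of the sum of the fourth powers of the axes; proportional nonzero
    harmonic parts of E and F give the same axes.  Conversely a common cubic basis
    puts E and F in this form ([cubic_basis_axes]), from which the traces, the
    harmonic parts and d2 are computed.  Finally the form determines the symmetry
    group ([cubic_of_axes]): a rotation fixes the sum of the fourth powers of the
    basis vectors exactly when its entries are 0, 1 or -1, which is also when it
    preserves the cube. *)

Set Implicit Arguments.
Unset Strict Implicit.
Unset Printing Implicit Defensive.

Import Order.TTheory GRing.Theory Num.Theory.
Import numFieldNormedType.Exports.
Local Open Scope ring_scope.
Local Open Scope classical_set_scope.

Local Notation o1 := (inord 0 : 'I_3).
Local Notation o2 := (inord 1 : 'I_3).
Local Notation o3 := (inord 2 : 'I_3).

(** * Quartic forms that are maximal at the pole *)

Lemma sqr_sum_eq0 (R : realDomainType) (x y : R) : x ^+ 2 + y ^+ 2 = 0 -> x = 0 /\ y = 0.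
Proof.
move=> /eqP; rewrite paddr_eq0 ?sqr_ge0// !sqrf_eq0.
by case/andP => /eqP-> /eqP->.
Qed.

Lemma le_sqr_bound (R : realDomainType) (x M : R) : - M <= x -> x <= M -> x ^+ 2 <= M ^+ 2.
Proof. by move=> h1 h2; nra. Qed.

Section PoleQuartic.
Variable R : realFieldType.

(** Harmonic quartics whose differential at the pole (0, 0, 1) is a multiple of that
    of the norm, that is, with no part of weight 1.  With w = x + iy the
    coefficients are the amplitudes a0 = A, a2 = b2 - i c2, a3 = B3 - i C3 and
    a4 = b4 - i c4 of the real parts of w^2, w^3 and w^4; the factor 4 makes
    B3 and C3 tensor components. *)
Definition harmonic_quartic (A b2 c2 B3 C3 b4 c4 x y z : R) : R :=
  A * (z ^+ 4 - 3 * z ^+ 2 * (x ^+ 2 + y ^+ 2) + 3 / 8 * (x ^+ 2 + y ^+ 2) ^+ 2)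
  + (b2 * (x ^+ 2 - y ^+ 2) + c2 * (2 * x * y)) * (6 * z ^+ 2 - (x ^+ 2 + y ^+ 2))
  + 4 * (B3 * (x ^+ 3 - 3 * x * y ^+ 2) + C3 * (3 * x ^+ 2 * y - y ^+ 3)) * z
  + b4 * (x ^+ 4 - 6 * x ^+ 2 * y ^+ 2 + y ^+ 4)
  + c4 * (4 * x ^+ 3 * y - 4 * x * y ^+ 3).

(** The five equations are the complex equations of weight 2 and 1 and the real one of
    weight 0 for the amplitudes.  The bound is used only at a few points with
    integer coordinates, chosen so that no angle has to be extracted from the
    amplitudes: the crude bound 5/6 for c4 is enough because what has to be excluded is
    |a4| = (15/8) A. *)
Lemma harmonic_quartic_maximal_at_pole (A b2 c2 B3 C3 b4 c4 : R) :
  (forall x y z, `|harmonic_quartic A b2 c2 B3 C3 b4 c4 x y z|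
                 <= A * (x ^+ 2 + y ^+ 2 + z ^+ 2) ^+ 2) ->
  15 / 8 * A * b2 = - (b2 * b4 + c2 * c4) ->
  15 / 8 * A * c2 = c2 * b4 - b2 * c4 ->
  5 * (b2 * B3 + c2 * C3) + 4 * (b4 * B3 + c4 * C3) = 0 ->
  5 * (b2 * C3 - c2 * B3) + 4 * (c4 * B3 - b4 * C3) = 0 ->
  2 * (b4 ^+ 2 + c4 ^+ 2) + (B3 ^+ 2 + C3 ^+ 2) - (b2 ^+ 2 + c2 ^+ 2)
    = 25 / 32 * A ^+ 2 ->
  [/\ b2 = 0, c2 = 0, B3 = 0, C3 = 0 & b4 ^+ 2 + c4 ^+ 2 = (5 / 8 * A) ^+ 2].
Proof.
move=> bound e2 e2' e1 e1' e0.
have test x y z : - (A * (x ^+ 2 + y ^+ 2 + z ^+ 2) ^+ 2)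
    <= harmonic_quartic A b2 c2 B3 C3 b4 c4 x y z
    <= A * (x ^+ 2 + y ^+ 2 + z ^+ 2) ^+ 2 by rewrite -ler_norml.
(* Pairs of equatorial points a quarter turn apart, for the angles of tangent 0, 1, 1/2 and 2;
   adding the values on a pair cancels the weight 2 part. *)
have := test 1 0 0; have := test 0 1 0; have := test 1 1 0.
have := test 1 (-1) 0; have := test 2 1 0; have := test (-1) 2 0.
have := test 1 2 0; have := test (-2) 1 0.
rewrite /harmonic_quartic => /andP[_ p1] /andP[_ p2] /andP[_ p3] /andP[_ p4].
move=> /andP[_ p5] /andP[_ p6] /andP[_ p7] /andP[_ p8].
have [A0 b4u b4l c4u c4l] : [/\ 0 <= A, b4 <= 5 / 8 * A, - (5 / 8 * A) <= b4,
    c4 <= 5 / 6 * A & - (5 / 6 * A) <= c4].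
  by clear -p1 p2 p3 p4 p5 p6 p7 p8; split; lra.
have b2c2 : A = 0 -> b2 = 0 /\ c2 = 0.
  by clear -p5 p6 p7 p8 b4u b4l c4u c4l => Az; split; lra.
clear p1 p2 p3 p4 p5 p6 p7 p8.
have b4s := le_sqr_bound b4l b4u.
have c4s := le_sqr_bound c4l c4u.
have [b20 c20] : b2 = 0 /\ c2 = 0.
  have [Az|An] := eqVneq A 0; first exact: b2c2.
  have Ap : 0 < A ^+ 2 by rewrite exprn_gt0// lt_neqAle eq_sym An.
  (* Comparing the squared moduli in the weight 2 equation gives
     (15/8)^2 A^2 = b4^2 + c4^2 unless b2 = c2 = 0. *)
  apply: sqr_sum_eq0; apply/eqP.
  have : (b2 ^+ 2 + c2 ^+ 2) * ((15 / 8 * A) ^+ 2 - (b4 ^+ 2 + c4 ^+ 2)) = 0.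
    have -> : (b2 ^+ 2 + c2 ^+ 2) * ((15 / 8 * A) ^+ 2 - (b4 ^+ 2 + c4 ^+ 2))
      = (15 / 8 * A * b2) ^+ 2 + (15 / 8 * A * c2) ^+ 2
        - (b2 ^+ 2 + c2 ^+ 2) * (b4 ^+ 2 + c4 ^+ 2) by ring.
    by rewrite e2 e2'; ring.
  by move=> /eqP; rewrite mulf_eq0 => /orP[//|/eqP]; rewrite !exprMn in b4s c4s *; lra.
subst b2 c2; clear b2c2 b4u b4l c4u c4l b4s c4s e2 e2'.
have : (B3 ^+ 2 + C3 ^+ 2) * (b4 ^+ 2 + c4 ^+ 2) = 0.
  have -> : (B3 ^+ 2 + C3 ^+ 2) * (b4 ^+ 2 + c4 ^+ 2)
    = (b4 * B3 + c4 * C3) ^+ 2 + (c4 * B3 - b4 * C3) ^+ 2 by ring.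
  have -> : b4 * B3 + c4 * C3 = 0 by lra.
  have -> : c4 * B3 - b4 * C3 = 0 by lra.
  by ring.
move=> /eqP; rewrite mulf_eq0 => /orP[] /eqP /sqr_sum_eq0[].
  by move=> ? ?; subst; split=> //; rewrite exprMn; lra.
move=> ? ?; subst.
(* Here b4 = c4 = 0 and the pole would be a threefold axis.  Such a form attains
   - (3/2) A on the cone of slope the square root of 2; the slope 3/2 is close enough. *)
have := test 3 0 2; have := test (-3) 0 2; have := test 0 3 2; have := test 0 (-3) 2.
rewrite /harmonic_quartic => /andP[q1 _] /andP[q2 _] /andP[q3 _] /andP[q4 _].
have [b3l b3u c3l c3u] : [/\ - (1 / 2 * A) <= B3, B3 <= 1 / 2 * A,
    - (1 / 2 * A) <= C3 & C3 <= 1 / 2 * A].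
  by clear -q1 q2 q3 q4 A0; split; lra.
have := le_sqr_bound b3l b3u; have := le_sqr_bound c3l c3u; rewrite !exprMn => r1 r2.
clear q1 q2 q3 q4 b3l b3u c3l c3u e1 e1' test bound.
have Az : A ^+ 2 = 0 by have := sqr_ge0 A; lra.
have /sqr_sum_eq0[? ?] : B3 ^+ 2 + C3 ^+ 2 = 0 by lra.
by split=> //; lra.
Qed.

(** The derivative at an interior maximum vanishes; stated for a polynomial so that it
    holds over any ordered field. *)
Lemma linear_coef_eq0 (b c2 c3 c4 : R) :
  (forall t, b * t + c2 * t ^+ 2 + c3 * t ^+ 3 + c4 * t ^+ 4 <= 0) -> b = 0.
Proof.
have coef_le0 (b' d2 d3 d4 : R) :
    (forall t, b' * t + d2 * t ^+ 2 + d3 * t ^+ 3 + d4 * t ^+ 4 <= 0) -> b' <= 0.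
  move=> h; rewrite leNgt; apply/negP => b0.
  (* On ]0, 1] the terms of higher degree are at most M t^2 in absolute value. *)
  pose M := 1 + `|d2| + `|d3| + `|d4|.
  have M1 : 1 <= M by rewrite /M -!addrA lerDl !addr_ge0.
  have key t : 0 < t -> t <= 1 -> b' <= M * t.
    move=> t0 t1; rewrite -(ler_pM2r t0).
    have t2 : 0 <= t ^+ 2 by rewrite sqr_ge0.
    have below d n : - (`|d| * t ^+ 2) <= d * t ^+ n.+2.
      rewrite -mulNr; apply: le_trans (_ : - `|d| * t ^+ n.+2 <= _).
        by rewrite !mulNr lerN2 ler_wpM2l// -addn2 exprD ler_piMl// exprn_ile1// ltW.
      by rewrite ler_wpM2r ?exprn_ge0 ?(ltW t0)// lerNl -normrN ler_norm.
    have := below d2 0%N; have := below d3 1%N; have := below d4 2%N.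
    by have := h t; rewrite /M -mulrA -expr2; lra.
  have [le1|gt1] := leP b' M.
    have M0 : 0 < M := lt_le_trans ltr01 M1.
    have := key (b' / (2 * M)); rewrite divr_gt0 ?mulr_gt0//.
    have -> : M * (b' / (2 * M)) = b' / 2 by field; rewrite gt_eqF.
    by rewrite ler_pdivrMr ?mulr_gt0//; lra.
  by have := key 1 ltr01 (lexx _); lra.
move=> h; apply/le_anti; rewrite (coef_le0 _ _ _ _ h)/= -oppr_le0.
by apply: (coef_le0 _ c2 (- c3) c4) => t; have := h (- t); rewrite !exprS expr0; lra.
Qed.
End PoleQuartic.

(** * Tensors and changes of basis *)

Lemma ord3P (i : 'I_3) : [\/ i = o1, i = o2 | i = o3].
Proof.
case: i => [[|[|[|//]]] hi]; [constructor 1|constructor 2|constructor 3];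
  by apply: val_inj; rewrite /= inordK.
Qed.

Lemma sum3 (V : zmodType) (F : 'I_3 -> V) : \sum_i F i = F o1 + F o2 + F o3.
Proof.
rewrite !big_ord_recl big_ord0 addr0 addrA; congr (F _ + F _ + F _);
  by apply: val_inj; rewrite /= inordK.
Qed.

(** Decides all comparisons of explicit indices; the indices are [inord]s, on which
    [==] does not compute. *)
Lemma ord3_eq : ((o1 == o1) = true) * ((o2 == o2) = true) * ((o3 == o3) = true) *
  ((o1 == o2) = false) * ((o2 == o1) = false) * ((o1 == o3) = false) *
  ((o3 == o1) = false) * ((o2 == o3) = false) * ((o3 == o2) = false).
Proof. by rewrite -!val_eqE /= !inordK. Qed.

(** Bubble sort of the index quadruple of a totally symmetric tensor, given the
    invariance under the three adjacent transpositions. *)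
Ltac sort_tot_sym s1 s2 s3 :=
  rewrite ?(s1 o2 o1, s1 o3 o1, s1 o3 o2, s2 _ o2 o1, s2 _ o3 o1, s2 _ o3 o2,
    s3 _ _ o2 o1, s3 _ _ o3 o1, s3 _ _ o3 o2).

(** The same for the symmetries of [Ela]: each pair is sorted, and then the two
    pairs are put in the order 11, 22, 33, 12, 13, 23. *)
Ltac sort_Ela s1 s2 s3 :=
  rewrite ?(s1 o2 o1, s1 o3 o1, s1 o3 o2, s2 _ _ o2 o1, s2 _ _ o3 o1, s2 _ _ o3 o2,
    s3 o2 o2 o1 o1, s3 o3 o3 o1 o1, s3 o3 o3 o2 o2,
    s3 o1 o2 o1 o1, s3 o1 o2 o2 o2, s3 o1 o2 o3 o3,
    s3 o1 o3 o1 o1, s3 o1 o3 o2 o2, s3 o1 o3 o3 o3,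
    s3 o1 o3 o1 o2, s3 o2 o3 o1 o1, s3 o2 o3 o2 o2,
    s3 o2 o3 o3 o3, s3 o2 o3 o1 o2, s3 o2 o3 o1 o3).

Section ChangeOfBasis.
Variable R : realType.
Implicit Types (P Q M : 'M[R]_3) (T E : tensor4 R).

Lemma tensorP T E : (forall i j k l, T (i, j, k, l) = E (i, j, k, l)) -> T = E.
Proof. by move=> h; apply/ffunP => -[[[i j] k] l]; exact: h. Qed.

(** The components of a tensor live in the regular module [R^o], whose scaling is the product. *)
Lemma scaleE (x y : R) : x *: (y : R^o) = x * y.
Proof. by []. Qed.

(** The action of a matrix on a single index.  The actions on distinct indices commute
    and [star] is their composite, so that an identity about [star] comes down to
    identities about one sum at a time. *)
Definition act1 Q T : tensor4 R := [ffun x => let: (i, j, k, l) := x in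
  \sum_(p < 3) Q i p * T (p, j, k, l)].
Definition act2 Q T : tensor4 R := [ffun x => let: (i, j, k, l) := x in
  \sum_(p < 3) Q j p * T (i, p, k, l)].
Definition act3 Q T : tensor4 R := [ffun x => let: (i, j, k, l) := x in
  \sum_(p < 3) Q k p * T (i, j, p, l)].
Definition act4 Q T : tensor4 R := [ffun x => let: (i, j, k, l) := x in
  \sum_(p < 3) Q l p * T (i, j, k, p)].

Lemma starE Q T : star Q T = act1 Q (act2 Q (act3 Q (act4 Q T))).
Proof.
apply: tensorP => i j k l; rewrite !ffunE.
apply: eq_bigr => p _; rewrite ffunE mulr_sumr; apply: eq_bigr => q _.
rewrite ffunE !mulr_sumr; apply: eq_bigr => r _.
rewrite ffunE !mulr_sumr; apply: eq_bigr => s _.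
by rewrite !mulrA.
Qed.

Ltac slots_commute := apply: tensorP => i j k l; rewrite !ffunE;
  under eq_bigr do rewrite ffunE mulr_sumr;
  under [RHS]eq_bigr do rewrite ffunE mulr_sumr;
  rewrite exchange_big /=; apply: eq_bigr => p _; apply: eq_bigr => q _;
  rewrite mulrCA.

Lemma act12 Q P T : act1 Q (act2 P T) = act2 P (act1 Q T). Proof. by slots_commute. Qed.
Lemma act13 Q P T : act1 Q (act3 P T) = act3 P (act1 Q T). Proof. by slots_commute. Qed.
Lemma act14 Q P T : act1 Q (act4 P T) = act4 P (act1 Q T). Proof. by slots_commute. Qed.
Lemma act23 Q P T : act2 Q (act3 P T) = act3 P (act2 Q T). Proof. by slots_commute. Qed.
Lemma act24 Q P T : act2 Q (act4 P T) = act4 P (act2 Q T). Proof. by slots_commute. Qed.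
Lemma act34 Q P T : act3 Q (act4 P T) = act4 P (act3 Q T). Proof. by slots_commute. Qed.

Ltac slot_comp := apply: tensorP => i j k l; rewrite !ffunE;
  under eq_bigr do rewrite ffunE mulr_sumr;
  rewrite exchange_big /=; apply: eq_bigr => p _; rewrite mxE mulr_suml;
  apply: eq_bigr => q _; rewrite mulrA.

Lemma act11 Q P T : act1 Q (act1 P T) = act1 (Q *m P) T. Proof. by slot_comp. Qed.
Lemma act22 Q P T : act2 Q (act2 P T) = act2 (Q *m P) T. Proof. by slot_comp. Qed.
Lemma act33 Q P T : act3 Q (act3 P T) = act3 (Q *m P) T. Proof. by slot_comp. Qed.
Lemma act44 Q P T : act4 Q (act4 P T) = act4 (Q *m P) T. Proof. by slot_comp. Qed.

Lemma star_comp Q P T : star Q (star P T) = star (Q *m P) T.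
Proof.
rewrite !starE -!act14 -!act24 -!act34 act44.
by rewrite -!act13 -!act23 act33 -!act12 act22 act11.
Qed.

Lemma star1 T : star 1%:M T = T.
Proof.
apply: tensorP => i j k l; rewrite starE.
have one (f : 'I_3 -> R) a : \sum_(p < 3) (1%:M : 'M[R]_3) a p * f p = f a.
  rewrite (bigD1 a)//= big1 ?mxE ?eqxx ?mul1r ?addr0// => b ab.
  by rewrite mxE eq_sym (negbTE ab) mul0r.
by rewrite ffunE one ffunE one ffunE one ffunE one.
Qed.

Lemma starD Q T E : star Q (T + E) = star Q T + star Q E.
Proof.
apply: tensorP => i j k l; rewrite !ffunE.
do 4!(rewrite -big_split; apply: eq_bigr => ? _).
by rewrite ffunE mulrDr.
Qed.

Lemma starZ Q (c : R) T : star Q (c *: T) = c *: star Q T.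
Proof.
apply: tensorP => i j k l; rewrite !ffunE.
do 4!(rewrite scaler_sumr; apply: eq_bigr => ? _).
by rewrite ffunE; exact: mulrCA.
Qed.

Lemma O3_tr P : O3 P -> O3 P^T.
Proof. by rewrite /O3/= trmxK => /mulmx1C. Qed.

Lemma O3_mulT P : O3 P -> P^T *m P = 1%:M.
Proof. by move=> /mulmx1C. Qed.

Lemma O3M P Q : O3 P -> O3 Q -> O3 (P *m Q).
Proof. by rewrite /O3/= => hP hQ; rewrite trmx_mul -mulmxA (mulmxA Q) hQ mul1mx. Qed.

Lemma starK P T : O3 P -> star P^T (star P T) = T.
Proof. by move=> /O3_mulT hP; rewrite star_comp hP star1. Qed.

Lemma parseval_O3 P (f g : 'I_3 -> R) : O3 P ->
  \sum_a (\sum_p P a p * f p) * (\sum_p P a p * g p) = \sum_p f p * g p.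
Proof.
move=> /O3_mulT hP.
under eq_bigr do rewrite big_distrlr/=.
rewrite exchange_big/=; apply: eq_bigr => p _.
rewrite exchange_big/= (bigD1 p)//= [X in _ + X]big1 ?addr0.
  transitivity ((P^T *m P) p p * (f p * g p)).
    by rewrite mxE mulr_suml; apply: eq_bigr => a _; rewrite mxE mulrACA.
  by rewrite hP mxE eqxx mul1r.
move=> q qp; transitivity ((P^T *m P) p q * (f p * g q)).
  by rewrite mxE mulr_suml; apply: eq_bigr => a _; rewrite mxE mulrACA.
by rewrite hP mxE eq_sym (negbTE qp) mul0r.
Qed.

Lemma contract_O3 P (f : 'I_3 -> 'I_3 -> R) : O3 P ->
  \sum_a \sum_p P a p * (\sum_q P a q * f p q) = \sum_p f p p.
Proof.
move=> hP; rewrite exchange_big/=; apply: eq_bigr => p _.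
have /= := parseval_O3 (fun q => (q == p)%:R) (f p) hP.
have pick (h : 'I_3 -> R) : \sum_q h q * (q == p)%:R = h p.
  rewrite (bigD1 p)//= eqxx mulr1 big1 ?addr0// => q /negbTE->.
  by rewrite mulr0.
under eq_bigr do rewrite pick.
move=> ->; rewrite -[RHS]pick; apply: eq_bigr => q _; exact: mulrC.
Qed.

Definition tot_sym T := forall i j k l,
  [/\ T (i, j, k, l) = T (j, i, k, l), T (i, j, k, l) = T (i, k, j, l) &
      T (i, j, k, l) = T (i, j, l, k)].
Definition traceless T := forall k l, \sum_(i < 3) T (i, i, k, l) = 0.

Lemma tot_sym_swaps T : tot_sym T ->
  [/\ forall i j k l, T (i, j, k, l) = T (j, i, k, l),
      forall i j k l, T (i, j, k, l) = T (i, k, j, l) &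
      forall i j k l, T (i, j, k, l) = T (i, j, l, k)].
Proof. by move=> h; split=> i j k l; case: (h i j k l). Qed.

Lemma Ela_swaps E : Ela E ->
  [/\ forall i j k l, E (i, j, k, l) = E (j, i, k, l),
      forall i j k l, E (i, j, k, l) = E (i, j, l, k) &
      forall i j k l, E (i, j, k, l) = E (k, l, i, j)].
Proof. by move=> h; split=> i j k l; case: (h i j k l). Qed.

Lemma star_swap12 Q T E i j k l :
  (forall a b c d, T (a, b, c, d) = E (b, a, c, d)) ->
  star Q T (i, j, k, l) = star Q E (j, i, k, l).
Proof.
move=> h; rewrite !ffunE exchange_big; do 4!apply: eq_bigr => ? _.
by rewrite h; congr (_ * _ * _ * _); exact: mulrC.
Qed.

Lemma star_swap23 Q T E i j k l :
  (forall a b c d, T (a, b, c, d) = E (a, c, b, d)) ->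
  star Q T (i, j, k, l) = star Q E (i, k, j, l).
Proof.
move=> h; rewrite !ffunE; apply: eq_bigr => ? _.
rewrite exchange_big; do 3!apply: eq_bigr => ? _.
by rewrite h; congr (_ * _ * _); rewrite -!mulrA [X in _ * X]mulrC.
Qed.

Lemma star_swap34 Q T E i j k l :
  (forall a b c d, T (a, b, c, d) = E (a, b, d, c)) ->
  star Q T (i, j, k, l) = star Q E (i, j, l, k).
Proof.
move=> h; rewrite !ffunE; do 2!apply: eq_bigr => ? _.
rewrite exchange_big; do 2!apply: eq_bigr => ? _.
by rewrite h; congr (_ * _); rewrite -!mulrA [X in _ * (_ * X)]mulrC.
Qed.

Lemma star_sym Q T : tot_sym T -> tot_sym (star Q T).
Proof.
move=> h i j k l; split.
- by apply: star_swap12 => a b c d; case: (h a b c d).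
- by apply: star_swap23 => a b c d; case: (h a b c d).
- by apply: star_swap34 => a b c d; case: (h a b c d).
Qed.

(** The exchange of the two index pairs is the product of four adjacent
    transpositions, and [star] commutes with each of these. *)
Lemma star_Ela Q E : Ela E -> Ela (star Q E).
Proof.
move=> h i j k l; split.
- by apply: star_swap12 => a b c d; case: (h a b c d).
- by apply: star_swap34 => a b c d; case: (h a b c d).
- pose E1 : tensor4 R := [ffun x => let: (i, j, k, l) := x in E (i, k, j, l)].
  pose E2 : tensor4 R := [ffun x => let: (i, j, k, l) := x in E (j, k, i, l)].
  pose E3 : tensor4 R := [ffun x => let: (i, j, k, l) := x in E (j, l, i, k)].
  rewrite (@star_swap23 Q E E1)=> [|*]; last by rewrite ffunE.
  rewrite (@star_swap12 Q E1 E2)=> [|*]; last by rewrite !ffunE.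
  rewrite (@star_swap34 Q E2 E3)=> [|*]; last by rewrite !ffunE.
  apply: star_swap23 => a b c d; rewrite !ffunE.
  by case: (h b d a c).
Qed.

Lemma star_traceless P T : O3 P -> traceless T -> traceless (star P T).
Proof.
move=> hP h k l; rewrite starE.
under eq_bigr do rewrite ffunE; under eq_bigr do under eq_bigr do rewrite ffunE.
rewrite (contract_O3 (fun p q => act3 P (act4 P T) (p, q, k, l)) hP).
under eq_bigr do rewrite ffunE.
rewrite exchange_big big1//= => p _; rewrite -mulr_sumr.
under eq_bigr do rewrite ffunE.
rewrite exchange_big big1 ?mulr0//= => q _; rewrite -mulr_sumr.
by rewrite h mulr0.
Qed.

Lemma d2_sym T i j : tot_sym T ->
  d2 T i j = \sum_p \sum_q \sum_r T (i, p, q, r) * T (j, p, q, r).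
Proof.
move=> h; rewrite mxE; do 3!apply: eq_bigr => ? _; congr (_ * _).
have [s1 s2 s3] := tot_sym_swaps h.
by rewrite s3 s2 s1.
Qed.

(** The quadratic covariant is equivariant: in each of the three contracted slots the
    change of basis disappears by Parseval, which leaves the action on the two free
    indices. *)
Lemma d2_star P T : O3 P -> tot_sym T -> d2 (star P T) = P *m d2 T *m P^T.
Proof.
move=> hP h; apply/matrixP => i j.
rewrite d2_sym; last exact: star_sym.
transitivity (\sum_p \sum_q \sum_r act1 P T (i, p, q, r) * act1 P T (j, p, q, r)).
  rewrite starE !(act14, act24, act34).
  under eq_bigr do under eq_bigr do
    (under eq_bigr do rewrite 2!ffunE; rewrite parseval_O3//).
  rewrite !(act13, act23).
  under eq_bigr do (rewrite exchange_big/=; under eq_bigr do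
    (under eq_bigr do rewrite 2!ffunE; rewrite parseval_O3//)).
  rewrite act12 exchange_big/=.
  under eq_bigr do (rewrite exchange_big/=; under eq_bigr do
    (under eq_bigr do rewrite 2!ffunE; rewrite parseval_O3//)).
  under eq_bigr do rewrite exchange_big.
  by rewrite exchange_big; apply: eq_bigr => q _; rewrite exchange_big.
transitivity (\sum_p \sum_q \sum_r \sum_a \sum_b
    P i a * P j b * (T (a, p, q, r) * T (b, p, q, r))).
  do 3!apply: eq_bigr => ? _; rewrite 2!ffunE big_distrlr.
  by do 2!apply: eq_bigr => ? _; rewrite mulrACA.
move: (d2 T) (fun a b => @d2_sym T a b h) => D hD.
have -> : (P *m D *m P^T) i j = \sum_a \sum_b P i a * P j b * D a b.
  rewrite exchange_big mxE; apply: eq_bigr => b _; rewrite !mxE mulr_suml.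
  by apply: eq_bigr => a _; rewrite mulrAC.
under [RHS]eq_bigr do under eq_bigr do rewrite hD pair_bigA pair_bigA mulr_sumr.
rewrite pair_bigA pair_bigA exchange_big; apply: eq_bigr => a _ /=.
by rewrite exchange_big.
Qed.
End ChangeOfBasis.

(** * The quartic form of a tensor and its maximum on the sphere *)

Section QuarticForm.
Variable R : realType.
Implicit Types (P Q M : 'M[R]_3) (T E : tensor4 R) (v : 'rV[R]_3).

Definition quartic T v : R := \sum_(p < 3) \sum_(q < 3) \sum_(r < 3) \sum_(s < 3)
  v 0 p * v 0 q * v 0 r * v 0 s * T (p, q, r, s).

Definition sqnorm v : R := \sum_(p < 3) v 0 p ^+ 2.

(** Every value of the quartic form is a diagonal component of some [star M T], so that its
    behaviour under [star] follows from [star_comp]. *)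
Lemma quartic_row M T i : quartic T (row i M) = star M T (i, i, i, i).
Proof. by rewrite ffunE; do 4!apply: eq_bigr => ? _; rewrite !mxE. Qed.

Lemma quartic_star P T v : quartic (star P T) v = quartic T (v *m P).
Proof.
have vE : v = row o1 (\matrix_(i, j) v 0 j) by apply/rowP => j; rewrite !mxE.
by rewrite [in LHS]vE quartic_row star_comp -quartic_row row_mul -vE.
Qed.

Lemma quarticZ (c : R) T v : quartic T (c *: v) = c ^+ 4 * quartic T v.
Proof.
rewrite mulr_sumr; apply: eq_bigr => p _; rewrite mulr_sumr; apply: eq_bigr => q _.
rewrite mulr_sumr; apply: eq_bigr => r _; rewrite mulr_sumr; apply: eq_bigr => s _.
by rewrite !mxE; ring.
Qed.

Lemma sqnormE v : sqnorm v = (v *m v^T) 0 0.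
Proof. by rewrite mxE; apply: eq_bigr => p _; rewrite mxE expr2. Qed.

Lemma sqnormZ (c : R) v : sqnorm (c *: v) = c ^+ 2 * sqnorm v.
Proof. by rewrite mulr_sumr; apply: eq_bigr => p _; rewrite mxE exprMn. Qed.

Lemma sqnorm_O3 P v : O3 P -> sqnorm (v *m P) = sqnorm v.
Proof. by move=> hP; rewrite !sqnormE trmx_mul mulmxA -(mulmxA v) hP mulmx1. Qed.

Lemma sqnorm_ge0 v : 0 <= sqnorm v.
Proof. by apply: sumr_ge0 => p _; exact: sqr_ge0. Qed.

Lemma sqnorm_delta i : sqnorm (delta_mx 0 i) = 1.
Proof.
rewrite /sqnorm (bigD1 i)//= big1 => [|p /negbTE pi]; rewrite !mxE !eqxx.
  by rewrite expr1n addr0.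
by rewrite pi expr0n.
Qed.

Lemma sqnorm_eq0 v : sqnorm v = 0 -> v = 0.
Proof.
move=> /eqP; rewrite psumr_eq0 => [/allP h|p _]; last exact: sqr_ge0.
by apply/rowP => p; have := h p (mem_index_enum _); rewrite mxE sqrf_eq0 => /eqP.
Qed.

Lemma quartic_continuous T : continuous (quartic T).
Proof.
have c i : continuous (fun v => v 0 i : R) by exact: coord_continuous.
rewrite /quartic.
apply: continuous_big => [|p _]; first exact: add_continuous.
apply: continuous_big => [|q _]; first exact: add_continuous.
apply: continuous_big => [|r _]; first exact: add_continuous.
apply: continuous_big => [|s _]; first exact: add_continuous.
move=> v; apply: (@continuousM R 'rV[R]_3 (fun v => v 0 p * v 0 q * v 0 r * v 0 s)
  (fun _ => T (p, q, r, s) : R)); last exact: cst_continuous.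
apply: (@continuousM R 'rV[R]_3 (fun v => v 0 p * v 0 q * v 0 r)); last exact: c.
apply: (@continuousM R 'rV[R]_3 (fun v => v 0 p * v 0 q)); last exact: c.
by apply: (@continuousM R 'rV[R]_3 (fun v => v 0 p)); exact: c.
Qed.

Lemma sqnorm_continuous : continuous sqnorm.
Proof.
apply: continuous_big => [|p _]; first exact: add_continuous.
by move=> v; under eq_fun do rewrite expr2; apply: continuousM; exact: coord_continuous.
Qed.

Lemma compact_sphere : compact [set v | sqnorm v = 1].
Proof.
have cube_compact := @rV_compact R 3 _ (fun _ : 'I_3 => @segment_compact R (- 1) 1).
apply: subclosed_compact cube_compact _.
  apply: (@preimage_closed _ _ sqnorm [set x | x = 1]); last exact: closed_eq.
  by move=> v _; exact: sqnorm_continuous.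
move=> v /= v1 i; rewrite in_itv/= -ler_norml -(@expr_le1 _ 2)//.
rewrite real_normK ?num_real// -v1 /sqnorm.
by rewrite (bigD1 i)//= lerDl sumr_ge0// => p _; exact: sqr_ge0.
Qed.

(** The maximum exists by compactness of the sphere; homogeneity turns the bound on the
    sphere into one for all vectors, which can then be tested at non-normalised points. *)
Lemma quartic_max T : exists2 v0, sqnorm v0 = 1 &
  forall v, `|quartic T v| <= `|quartic T v0| * sqnorm v ^+ 2.
Proof.
have nonempty : [set v | sqnorm v = 1] !=set0.
  by exists (delta_mx 0 o1); exact: sqnorm_delta.
have cont : {within [set v | sqnorm v = 1], continuous (fun v => `|quartic T v|)}.
  apply: continuous_subspaceT => v.
  apply: (continuous_comp (@quartic_continuous T v)); exact: norm_continuous.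
have [v0] := EVT_max_rV nonempty compact_sphere cont.
rewrite inE/= => v01 vmax; exists v0 => // v.
have [/sqnorm_eq0 ->|vn0] := eqVneq (sqnorm v) 0.
  by rewrite -(scale0r (0 : 'rV[R]_3)) quarticZ sqnormZ !expr0n/= !mul0r normr0 expr0n mulr0.
have v_gt0 : 0 < sqnorm v by rewrite lt_neqAle eq_sym vn0 sqnorm_ge0.
pose c := Num.sqrt (sqnorm v).
have c0 : 0 < c by rewrite sqrtr_gt0.
have c2 : c ^+ 2 = sqnorm v by rewrite sqr_sqrtr ?sqnorm_ge0.
have : `|quartic T (c^-1 *: v)| <= `|quartic T v0|.
  by apply: vmax; rewrite inE/= sqnormZ exprVn c2 mulVf.
rewrite quarticZ normrM exprVn ger0_norm ?invr_ge0 ?exprn_ge0 ?(ltW c0)//.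
by rewrite ler_pdivrMl ?exprn_gt0// -c2 -exprM mulrC.
Qed.

(** The Householder reflection along v - e3 exchanges e3 and v. *)
Lemma O3_with_row v : sqnorm v = 1 -> exists2 P, O3 P & row o3 P = v.
Proof.
move=> v1; pose e : 'rV[R]_3 := delta_mx 0 o3.
(* The reflection vector v - e must not vanish. *)
have [->|ve] := eqVneq v e.
  by exists 1%:M; [rewrite /O3/= trmx1 mulmx1|rewrite rowE mulmx1].
have [u uE] : exists u, u = v - e by exists (v - e).
have [n nE] : exists n, n = sqnorm u by exists (sqnorm u).
have n0 : n != 0.
  by rewrite nE; apply: contra_neq ve => /sqnorm_eq0/eqP; rewrite uE subr_eq0 => /eqP.
have uu : u *m u^T = n%:M by rewrite [LHS]mx11_scalar -sqnormE -nE.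
pose P : 'M[R]_3 := 1%:M - (2 / n) *: (u^T *m u).
exists P.
  have PT : P^T = P by rewrite /P linearB/= linearZ/= trmx1 trmx_mul trmxK.
  rewrite /O3/= PT.
  rewrite /P mulmxBl mul1mx mulmxBr mulmx1 -scalemxAl -scalemxAr.
  rewrite mulmxA -(mulmxA u^T) uu mul_mx_scalar -scalemxAl !scalerA.
  have -> : 2 / n * (2 / n * n) = 2 / n + 2 / n by field.
  by rewrite scalerDl opprB addrK subrK.
have eu : 2 * (e *m u^T) 0 0 = - n.
  rewrite nE /sqnorm mxE !sum3 uE !mxE !eqxx !ord3_eq/=.
  by move: v1; rewrite /sqnorm sum3; lra.
rewrite rowE mulmxBr mulmx1 -scalemxAr mulmxA [e *m _]mx11_scalar mul_scalar_mx scalerA.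
by rewrite mulrAC eu mulNr divff// scaleN1r opprK uE addrC subrK.
Qed.
End QuarticForm.

(** * Isotropic tensors and sums of fourth powers of axes *)

Section Axes.
Variable R : realType.
Implicit Types (P Q M : 'M[R]_3) (T E : tensor4 R) (v : 'rV[R]_3).

(** The sum of the fourth tensor powers of the rows of M.  For M in [O3], an isotropic
    tensor plus a nonzero multiple of [axes M] is the general cubic tensor with the
    rows of M as cubic axes. *)
Definition axes M : tensor4 R := [ffun x => let: (i, j, k, l) := x in
  \sum_(p < 3) M p i * M p j * M p k * M p l].

Definition delta (i j : 'I_3) : R := (i == j)%:R.

Definition isotropic (lam mu : R) : tensor4 R := [ffun x => let: (i, j, k, l) := x in
  lam * (delta i j * delta k l) + mu * (delta i k * delta j l + delta i l * delta j k)].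

Lemma star_axes Q M : star Q (axes M) = axes (M *m Q^T).
Proof.
apply: tensorP => i j k l; rewrite !ffunE.
transitivity (\sum_a (\sum_p Q i p * M a p) * (\sum_p Q j p * M a p) *
   (\sum_p Q k p * M a p) * (\sum_p Q l p * M a p)); last first.
  apply: eq_bigr => a _; rewrite !mxE.
  by congr (_ * _ * _ * _); apply: eq_bigr => p _; rewrite mxE mulrC.
under eq_bigr do under eq_bigr do under eq_bigr do under eq_bigr do rewrite ffunE mulr_sumr.
rewrite pair_bigA pair_bigA pair_bigA exchange_big; apply: eq_bigr => a _ /=.
rewrite -(pair_bigA _ (fun x s => Q i x.1.1 * Q j x.1.2 * Q k x.2 * Q l s *
  (M a x.1.1 * M a x.1.2 * M a x.2 * M a s)))/=.
rewrite -(pair_bigA _ (fun x r => \sum_s Q i x.1 * Q j x.2 * Q k r * Q l s *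
  (M a x.1 * M a x.2 * M a r * M a s)))/=.
rewrite -(pair_bigA _ (fun p q => \sum_r \sum_s Q i p * Q j q * Q k r * Q l s *
  (M a p * M a q * M a r * M a s)))/=.
rewrite -!mulrA mulr_suml; apply: eq_bigr => p _.
rewrite mulr_suml mulr_sumr; apply: eq_bigr => q _.
rewrite mulr_suml !mulr_sumr; apply: eq_bigr => r _.
by rewrite !mulr_sumr; apply: eq_bigr => s _; ring.
Qed.

Lemma O3_rows Q i j : O3 Q ->
  Q i o1 * Q j o1 + Q i o2 * Q j o2 + Q i o3 * Q j o3 = delta i j.
Proof.
move=> hQ; have : (Q *m Q^T) i j = (1%:M : 'M[R]_3) i j by rewrite hQ.
by rewrite !mxE sum3 !mxE.
Qed.

Lemma star_isotropic Q lam mu : O3 Q -> star Q (isotropic lam mu) = isotropic lam mu.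
Proof.
move=> hQ; apply: tensorP => i j k l; rewrite !ffunE.
by rewrite -!(O3_rows _ _ hQ) !sum3 !ffunE /delta !ord3_eq/=; ring.
Qed.

(** The multinomial coefficients reduce 27 terms to 10. *)
Lemma sum3_sym (g : 'I_3 -> 'I_3 -> 'I_3 -> R) :
  (forall p q r, g p q r = g q p r) -> (forall p q r, g p q r = g p r q) ->
  \sum_p \sum_q \sum_r g p q r =
  g o1 o1 o1 + g o2 o2 o2 + g o3 o3 o3 + 6 * g o1 o2 o3 +
  3 * (g o1 o1 o2 + g o1 o1 o3 + g o1 o2 o2 + g o2 o2 o3 + g o1 o3 o3 + g o2 o3 o3).
Proof.
move=> g1 g2; rewrite !sum3.
rewrite !(g1 o2 o1, g1 o3 o1, g1 o3 o2, g2 _ o2 o1, g2 _ o3 o1, g2 _ o3 o2); ring.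
Qed.

Lemma quarticE T v : tot_sym T ->
  let x := v 0 o1 in let y := v 0 o2 in let z := v 0 o3 in
  quartic T v =
   T (o1, o1, o1, o1) * x ^+ 4 + 4 * T (o1, o1, o1, o2) * x ^+ 3 * y +
   4 * T (o1, o1, o1, o3) * x ^+ 3 * z + 6 * T (o1, o1, o2, o2) * x ^+ 2 * y ^+ 2 +
   12 * T (o1, o1, o2, o3) * x ^+ 2 * y * z + 6 * T (o1, o1, o3, o3) * x ^+ 2 * z ^+ 2 +
   4 * T (o1, o2, o2, o2) * x * y ^+ 3 + 12 * T (o1, o2, o2, o3) * x * y ^+ 2 * z +
   12 * T (o1, o2, o3, o3) * x * y * z ^+ 2 + 4 * T (o1, o3, o3, o3) * x * z ^+ 3 +
   T (o2, o2, o2, o2) * y ^+ 4 + 4 * T (o2, o2, o2, o3) * y ^+ 3 * z +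
   6 * T (o2, o2, o3, o3) * y ^+ 2 * z ^+ 2 + 4 * T (o2, o3, o3, o3) * y * z ^+ 3 +
   T (o3, o3, o3, o3) * z ^+ 4.
Proof.
move=> h x y z.
have [s1 s2 s3] := tot_sym_swaps h.
have cubic p : \sum_q \sum_r \sum_s v 0 p * v 0 q * v 0 r * v 0 s * T (p, q, r, s) =
  v 0 p * \sum_q \sum_r \sum_s (v 0 q * v 0 r * v 0 s * T (p, q, r, s)).
  rewrite mulr_sumr; apply: eq_bigr => q _; rewrite mulr_sumr; apply: eq_bigr => r _.
  by rewrite mulr_sumr; apply: eq_bigr => s _; rewrite !mulrA.
rewrite /quartic; under eq_bigr do rewrite cubic.
rewrite sum3 !sum3_sym -/x -/y -/z;
  try by move=> p q r /=; first [rewrite (s2 _ p q r); ring | rewrite (s3 _ p q r); ring].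
by sort_tot_sym s1 s2 s3; ring.
Qed.

Lemma d2E T i j : tot_sym T ->
  let f p q r := T (i, p, q, r) * T (j, p, q, r) in
  d2 T i j = f o1 o1 o1 + f o2 o2 o2 + f o3 o3 o3 + 6 * f o1 o2 o3 +
  3 * (f o1 o1 o2 + f o1 o1 o3 + f o1 o2 o2 + f o2 o2 o3 + f o1 o3 o3 + f o2 o3 o3).
Proof.
move=> h f; rewrite d2_sym// (sum3_sym (g := f))// /f => p q r.
  by have [_ -> _] := h i p q r; have [_ -> _] := h j p q r.
by have [_ _ ->] := h i p q r; have [_ _ ->] := h j p q r.
Qed.
End Axes.

(** * Rotations about the pole and harmonic components *)

Section Pole.
Variable R : realType.
Implicit Types (P Q M : 'M[R]_3) (T E : tensor4 R) (v : 'rV[R]_3).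

Lemma half_angle (b c : R) : b ^+ 2 + c ^+ 2 = 1 ->
  exists x y, [/\ x ^+ 2 + y ^+ 2 = 1, x ^+ 2 - y ^+ 2 = b & 2 * x * y = c].
Proof.
move=> bc; have [b1|b1] := eqVneq (1 + b) 0.
  have -> : c = 0 by apply/eqP; rewrite -sqrf_eq0; apply/eqP; nra.
  by exists 0, 1; split; lra.
have b_gt : 0 < (1 + b) / 2.
  rewrite divr_gt0// lt_neqAle eq_sym b1/=.
  by have := sqr_ge0 c; nra.
pose x := Num.sqrt ((1 + b) / 2).
have x0 : x != 0 by rewrite gt_eqF// sqrtr_gt0.
have x2 : x ^+ 2 = (1 + b) / 2 by rewrite sqr_sqrtr// ltW.
have y2 : (c / (2 * x)) ^+ 2 = (1 - b) / 2.
  rewrite expr_div_n exprMn x2; have -> : c ^+ 2 = (1 + b) * (1 - b) by lra.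
  by field.
exists x, (c / (2 * x)); rewrite y2 x2; split; [lra|lra|by field].
Qed.

(** The fourth power is onto on the unit circle: take a square root twice. *)
Lemma quarter_angle (b c : R) : b ^+ 2 + c ^+ 2 = 1 ->
  exists x y, [/\ x ^+ 2 + y ^+ 2 = 1, x ^+ 4 - 6 * x ^+ 2 * y ^+ 2 + y ^+ 4 = b
    & 4 * x ^+ 3 * y - 4 * x * y ^+ 3 = c].
Proof.
move=> /half_angle[b' [c' [/half_angle[x [y [xy <- <-]]] <- <-]]].
by exists x, y; split=> //; ring.
Qed.

Definition vec3 (x y z : R) : 'rV[R]_3 :=
  \row_i (if i == o1 then x else if i == o2 then y else z).

(** The rotation of the first two basis vectors by the angle with cosine c and sine s. *)
Definition rot3 (c s : R) : 'M[R]_3 := \matrix_(i, j)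
  (if i == o1 then vec3 c s 0 else if i == o2 then vec3 (- s) c 0 else vec3 0 0 1) 0 j.

Lemma rot3_O3 c s : c ^+ 2 + s ^+ 2 = 1 -> O3 (rot3 c s).
Proof.
move=> cs; apply/matrixP => i j; rewrite !mxE sum3 !mxE.
by case: (ord3P i) => ->; case: (ord3P j) => ->; rewrite !ord3_eq !mxE !ord3_eq/=; lra.
Qed.

Lemma tot_symD T E : tot_sym T -> tot_sym E -> tot_sym (T + E).
Proof.
move=> hT hE i j k l; rewrite !ffunE.
by have [t1 t2 t3] := hT i j k l; have [e1 e2 e3] := hE i j k l; split; congr (_ + _).
Qed.

Lemma tot_symZ (c : R) T : tot_sym T -> tot_sym (c *: T).
Proof.
move=> hT i j k l; rewrite !ffunE.
by have [t1 t2 t3] := hT i j k l; split; congr (_ *: _).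
Qed.

Lemma tracelessD T E : traceless T -> traceless E -> traceless (T + E).
Proof.
by move=> hT hE k l; under eq_bigr do rewrite ffunE; rewrite big_split/= hT hE addr0.
Qed.

Lemma tracelessZ (c : R) T : traceless T -> traceless (c *: T).
Proof.
by move=> hT k l; under eq_bigr do rewrite ffunE; rewrite -scaler_sumr hT scaler0.
Qed.

(** The harmonic part of [axes M] for orthogonal M: the coefficient 1/5 makes it traceless. *)
Definition cubic_harmonic M : tensor4 R := axes M - isotropic 5^-1 5^-1.

Lemma cubic_harmonic_sym M : tot_sym (cubic_harmonic M).
Proof.
have dC (i j : 'I_3) : delta R i j = delta R j i by rewrite /delta eq_sym.
apply: tot_symD => i j k l; rewrite !ffunE.
  by split; apply: eq_bigr => p _; ring.
by rewrite (dC j i) (dC l k) (dC k j); split; ring.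
Qed.

Lemma O3_cols Q i j : O3 Q ->
  Q o1 i * Q o1 j + Q o2 i * Q o2 j + Q o3 i * Q o3 j = delta R i j.
Proof. by move=> /O3_tr/(O3_rows i j); rewrite !mxE. Qed.

Lemma trace12_axes M k l : O3 M -> \sum_i axes M (i, i, k, l) = delta R k l.
Proof.
move=> hM; rewrite -(O3_cols k l hM) -(sum3 (fun p => M p k * M p l)).
under eq_bigr do rewrite ffunE.
rewrite exchange_big; apply: eq_bigr => p _ /=; rewrite sum3.
have pp : M p o1 * M p o1 + M p o2 * M p o2 + M p o3 * M p o3 = 1.
  by rewrite O3_rows// /delta eqxx.
by rewrite -[RHS]mul1r -[in RHS]pp; ring.
Qed.

Lemma trace12_isotropic lam mu k l :
  \sum_i isotropic lam mu (i, i, k, l) = (3 * lam + 2 * mu) * delta R k l.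
Proof.
rewrite sum3 !ffunE /delta.
by case: (ord3P k) => ->; case: (ord3P l) => ->; rewrite !ord3_eq/=; ring.
Qed.

Lemma cubic_harmonic_traceless M : O3 M -> traceless (cubic_harmonic M).
Proof.
move=> hM k l; under eq_bigr do rewrite ffunE [X in _ + X]ffunE.
by rewrite big_split/= sumrN trace12_axes// trace12_isotropic; field.
Qed.

Lemma harmonic_traces T : tot_sym T -> traceless T ->
  [/\ T (o1, o1, o1, o1) + T (o1, o1, o2, o2) + T (o1, o1, o3, o3) = 0,
      T (o1, o1, o2, o2) + T (o2, o2, o2, o2) + T (o2, o2, o3, o3) = 0 &
      T (o1, o1, o3, o3) + T (o2, o2, o3, o3) + T (o3, o3, o3, o3) = 0] /\
  [/\ T (o1, o1, o1, o2) + T (o1, o2, o2, o2) + T (o1, o2, o3, o3) = 0,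
      T (o1, o1, o1, o3) + T (o1, o2, o2, o3) + T (o1, o3, o3, o3) = 0 &
      T (o1, o1, o2, o3) + T (o2, o2, o2, o3) + T (o2, o3, o3, o3) = 0].
Proof.
move=> h tr.
have [s1 s2 s3] := tot_sym_swaps h.
have := tr o1 o1; have := tr o2 o2; have := tr o3 o3.
have := tr o1 o2; have := tr o1 o3; have := tr o2 o3.
rewrite !sum3; sort_tot_sym s1 s2 s3.
by move=> -> -> -> -> -> ->.
Qed.

(** A harmonic tensor has nine independent components; these nine combinations are
    grouped by weight under the rotations about e3: weights 0 and 1, weights 2 and 3,
    and the two parts of weight 4. *)
Lemma harmonic_eq0 T : tot_sym T -> traceless T ->
  [/\ T (o3, o3, o3, o3) = 0, T (o1, o3, o3, o3) = 0 & T (o2, o3, o3, o3) = 0] ->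
  [/\ T (o1, o1, o3, o3) = T (o2, o2, o3, o3), T (o1, o2, o3, o3) = 0,
      T (o1, o1, o1, o3) = 0 & T (o1, o1, o2, o3) = 0] ->
  T (o1, o1, o1, o1) + T (o2, o2, o2, o2) = 0 ->
  T (o1, o1, o1, o2) = T (o1, o2, o2, o2) -> T = 0.
Proof.
move=> h tr [w0 w1 w1'] [w2 w2' w3 w3'] w4 w4'.
have [s1 s2 s3] := tot_sym_swaps h.
have [[t1 t2 t3] [t12 t13 t23]] := harmonic_traces h tr.
have z1133 : T (o1, o1, o3, o3) = 0 by lra.
have z2233 : T (o2, o2, o3, o3) = 0 by lra.
have z1122 : T (o1, o1, o2, o2) = 0 by lra.
have z1111 : T (o1, o1, o1, o1) = 0 by lra.
have z2222 : T (o2, o2, o2, o2) = 0 by lra.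
have z1112 : T (o1, o1, o1, o2) = 0 by lra.
have z1222 : T (o1, o2, o2, o2) = 0 by lra.
have z1223 : T (o1, o2, o2, o3) = 0 by lra.
have z2223 : T (o2, o2, o2, o3) = 0 by lra.
apply: tensorP => i j k l; rewrite [RHS]ffunE.
case: (ord3P i) => ->; case: (ord3P j) => ->; case: (ord3P k) => ->; case: (ord3P l) => ->.
all: sort_tot_sym s1 s2 s3.
all: exact.
Qed.

End Pole.

(** * Harmonic tensors with isotropic quadratic covariant *)

Section Classification.
Variable R : realType.
Implicit Types (P Q M : 'M[R]_3) (T E : tensor4 R) (v : 'rV[R]_3).

(** The amplitudes of [harmonic_quartic] are read off the components of T, and the
    entries of the scalar matrix d2(T) turn into the equations of
    [harmonic_quartic_maximal_at_pole].  In the cubic frame found, the value at the pole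
    is c (1 - 3/5) for the factor c of [cubic_harmonic], whence 5/2. *)
Lemma harmonic_maximal_at_pole T e : tot_sym T -> traceless T -> d2 T = e%:M ->
  (forall v, `|quartic T v| <= T (o3, o3, o3, o3) * sqnorm v ^+ 2) ->
  exists2 Q, O3 Q & T = (5 / 2 * T (o3, o3, o3, o3)) *: cubic_harmonic Q.
Proof.
move=> h tr d2T bound.
have [s1 s2 s3] := tot_sym_swaps h.
have [[t1 t2 t3] [t12 t13 t23]] := harmonic_traces h tr.
set A : R := T (o3, o3, o3, o3) in bound *.
have sqn (x y z : R) : sqnorm (vec3 x y z) = x ^+ 2 + y ^+ 2 + z ^+ 2.
  by rewrite /sqnorm sum3 !mxE !ord3_eq.
have T1333 : T (o1, o3, o3, o3) = 0.
  (* Restrict the form to the line t e1 + e3; the coefficients are those of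
     h(t, 0, 1) - A (t^2 + 1)^2. *)
  suff : 4 * T (o1, o3, o3, o3) = 0 by lra.
  apply: (@linear_coef_eq0 _ _ (6 * T (o1, o1, o3, o3) - 2 * A)
     (4 * T (o1, o1, o1, o3)) (T (o1, o1, o1, o1) - A)) => t.
  have := le_trans (ler_norm _) (bound (vec3 t 0 1)).
  by rewrite quarticE// sqn !mxE !ord3_eq/= -/A; lra.
have T2333 : T (o2, o3, o3, o3) = 0.
  suff : 4 * T (o2, o3, o3, o3) = 0 by lra.
  apply: (@linear_coef_eq0 _ _ (6 * T (o2, o2, o3, o3) - 2 * A)
     (4 * T (o2, o2, o2, o3)) (T (o2, o2, o2, o2) - A)) => t.
  have := le_trans (ler_norm _) (bound (vec3 0 t 1)).
  by rewrite quarticE// sqn !mxE !ord3_eq/= -/A; lra.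
(* The coefficients of [harmonic_quartic] in terms of the components: for instance x^2 z^2 has
   coefficient 6 T1133 in the form and 6 b2 - 3 A in [harmonic_quartic]. *)
pose b2 : R := (T (o1, o1, o3, o3) - T (o2, o2, o3, o3)) / 2.
pose c2 : R := T (o1, o2, o3, o3).
pose b3 : R := T (o1, o1, o1, o3).
pose c3 : R := T (o1, o1, o2, o3).
pose b4 : R := (T (o1, o1, o1, o1) + T (o2, o2, o2, o2)) / 2 - 3 / 8 * A.
pose c4 : R := (T (o1, o1, o1, o2) - T (o1, o2, o2, o2)) / 2.
have e1133 : T (o1, o1, o3, o3) = - A / 2 + b2 by rewrite /b2 /A; lra.
have e2233 : T (o2, o2, o3, o3) = - A / 2 - b2 by rewrite /b2 /A; lra.
have e1223 : T (o1, o2, o2, o3) = - b3 by rewrite /b3; lra.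
have e2223 : T (o2, o2, o2, o3) = - c3 by rewrite /c3; lra.
have e1111 : T (o1, o1, o1, o1) = 3 / 8 * A - b2 + b4 by rewrite /b4 /b2 /A; lra.
have e2222 : T (o2, o2, o2, o2) = 3 / 8 * A + b2 + b4 by rewrite /b4 /b2 /A; lra.
have e1122 : T (o1, o1, o2, o2) = A / 8 - b4 by rewrite /b4 /A; lra.
have e1112 : T (o1, o1, o1, o2) = c4 - c2 / 2 by rewrite /c4 /c2; lra.
have e1222 : T (o1, o2, o2, o2) = - c4 - c2 / 2 by rewrite /c4 /c2; lra.
have e1233 : T (o1, o2, o3, o3) = c2 by [].
have e1113 : T (o1, o1, o1, o3) = b3 by [].
have e1123 : T (o1, o1, o2, o3) = c3 by [].
have e3333 : T (o3, o3, o3, o3) = A by [].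
clearbody A b2 c2 b3 c3 b4 c4.
have components := (e3333, e1233, e1113, e1123, e1133, e2233, e1223, e2223,
  e1111, e2222, e1122, e1112, e1222, T1333, T2333).
have d2ij i j : d2 T i j = (if i == j then e else 0) by rewrite d2T mxE; case: eqP.
have := d2ij o1 o2; have := d2ij o1 o3; have := d2ij o2 o3.
have := d2ij o1 o1; have := d2ij o2 o2; have := d2ij o3 o3.
rewrite !d2E// !ord3_eq; sort_tot_sym s1 s2 s3.
rewrite ?components => d33 d22 d11 d23 d13 d12.
have bound' (x y z : R) : `|harmonic_quartic A b2 c2 b3 c3 b4 c4 x y z|
    <= A * (x ^+ 2 + y ^+ 2 + z ^+ 2) ^+ 2.
  have := bound (vec3 x y z); rewrite sqn quarticE// !mxE !ord3_eq/= ?components.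
  congr (`|_| <= _); rewrite /harmonic_quartic.
  by field.
clear t1 t2 t3 t12 t13 t23 e1223 e2223 e1122 components d2ij d2T bound.
have : [/\ b2 = 0, c2 = 0, b3 = 0, c3 = 0 & b4 ^+ 2 + c4 ^+ 2 = (5 / 8 * A) ^+ 2].
  clear -bound' d11 d12 d13 d22 d23 d33.
  apply: harmonic_quartic_maximal_at_pole bound' _ _ _ _ _; lra.
move=> [b20 c20 b30 c30 b4c4].
have [c [s [cs cs4 cs4']]] : exists c s, [/\ c ^+ 2 + s ^+ 2 = 1,
    b4 = 5 / 8 * A * (c ^+ 4 - 6 * c ^+ 2 * s ^+ 2 + s ^+ 4) &
    c4 = 5 / 8 * A * (4 * c ^+ 3 * s - 4 * c * s ^+ 3)].
  have [A0|A0] := eqVneq A 0.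
    (* If A = 0 the whole form vanishes and any angle will do. *)
    exists 1, 0; move: b4c4; rewrite A0 mulr0 expr0n/= => /sqr_sum_eq0[-> ->].
    by split; ring.
  have A0' : 5 / 8 * A != 0 by rewrite mulf_neq0// gt_eqF// divr_gt0.
  have unit_b4c4 : (b4 / (5 / 8 * A)) ^+ 2 + (c4 / (5 / 8 * A)) ^+ 2 = 1.
    by rewrite !expr_div_n -mulrDl b4c4 divff// expf_neq0.
  have [c [s [cs eb ec]]] := quarter_angle unit_b4c4.
  by exists c, s; rewrite eb ec; split=> //; rewrite mulrC divfK.
exists (rot3 c s); first exact: rot3_O3.
apply/eqP; rewrite -subr_eq0 -scaleNr; apply/eqP.
have hQ := rot3_O3 cs.
(* Given this consequence of c^2 + s^2 = 1, the remaining identities are linear in the monomials. *)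
have Acs : A * (c ^+ 2 + s ^+ 2) ^+ 2 = A by rewrite cs expr1n mulr1.
apply: harmonic_eq0.
- apply: tot_symD => //; apply: tot_symZ; exact: cubic_harmonic_sym.
- apply: tracelessD => //; apply: tracelessZ; exact: cubic_harmonic_traceless.
clear d11 d12 d13 d22 d23 d33 bound' b4c4.
all: rewrite !ffunE !sum3 !mxE /delta !ord3_eq !mxE !ord3_eq/=
  ?(e3333, e1233, e1113, e1123, e1133, e2233, e1111, e2222, e1112, e1222).
all: rewrite ?(b20, c20, b30, c30, cs4, cs4', T1333, T2333) !scaleE; clear -Acs.
- by split; lra.
- by split; lra.
- by lra.
- by lra.
Qed.

Lemma star_cubic_harmonic Q M : O3 Q ->
  star Q (cubic_harmonic M) = cubic_harmonic (M *m Q^T).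
Proof.
by move=> hQ; rewrite starD -scaleN1r starZ scaleN1r star_axes star_isotropic.
Qed.

(** The frame is the composite of the reflection that brings a maximum of |h| to the pole
    and the rotation about the pole given by [harmonic_maximal_at_pole]. *)
Lemma isotropic_d2_cubic_harmonic T e : tot_sym T -> traceless T -> d2 T = e%:M ->
  exists2 P, O3 P & exists c, T = c *: cubic_harmonic P.
Proof.
move=> h tr d2T; have [v0 v01 vmax] := quartic_max T.
(* Replacing T by its opposite changes the sign of the form and leaves d2 unchanged. *)
wlog pos : T h tr d2T vmax / 0 <= quartic T v0.
  move=> ih; have [/ih|neg] := leP 0 (quartic T v0); first exact.
  have quarticN v : quartic (-1 *: T) v = - quartic T v.
    rewrite /quartic; do 4!(rewrite -sumrN; apply: eq_bigr => ? _).
    by rewrite !ffunE scaleN1r mulrN.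
  have d2N : d2 (- 1 *: T) = d2 T.
    apply/matrixP => i j; rewrite !mxE; do 3!apply: eq_bigr => ? _.
    by rewrite !ffunE !scaleN1r mulrNN.
  have [|||||P hP [c Tc]] := ih (- 1 *: T).
  - exact: tot_symZ.
  - exact: tracelessZ.
  - by rewrite d2N.
  - by move=> v; rewrite !quarticN !normrN.
  - by rewrite quarticN oppr_ge0 ltW.
  exists P => //; exists (- c).
  by rewrite scaleNr -Tc scaleN1r opprK.
have [P hP rowP] := O3_with_row v01.
have pole : star P T (o3, o3, o3, o3) = quartic T v0 by rewrite -quartic_row rowP.
have [||||Q hQ TQ] := @harmonic_maximal_at_pole (star P T) e.
- exact: star_sym.
- exact: star_traceless.
- by rewrite d2_star// d2T mul_mx_scalar -scalemxAl hP scalemx1.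
- by move=> v; rewrite pole quartic_star -(sqnorm_O3 v hP) -[X in _ <= X * _]ger0_norm.
exists (Q *m P); first exact: O3M.
exists (5 / 2 * star P T (o3, o3, o3, o3)).
rewrite -[LHS](starK T hP) [in LHS]TQ starZ star_cubic_harmonic ?trmxK//.
exact: O3_tr.
Qed.

End Classification.

(** * The symmetry group of a cubic tensor *)

Section CubicTensors.
Variable R : realType.
Implicit Types (P Q M g : 'M[R]_3) (T E F : tensor4 R).

Lemma axes1E i j k l : axes 1%:M (i, j, k, l) = ((i == j) && (i == k) && (i == l))%:R :> R.
Proof.
rewrite ffunE (bigD1 i)//= big1 ?addr0 => [|p /negbTE pi].
  by rewrite !mxE eqxx mul1r; do 3!case: (i == _); rewrite !(mul1r, mul0r, mulr0).
by rewrite !mxE pi !mul0r.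
Qed.

(** On [0, 1] squares are at most their arguments, and here equality holds in the sum. *)
Lemma unit_sum_idempotent (u v w : R) : 0 <= u -> 0 <= v -> 0 <= w ->
  u + v + w <= 1 -> u ^+ 2 + v ^+ 2 + w ^+ 2 = 1 ->
  [/\ u ^+ 2 = u, v ^+ 2 = v & w ^+ 2 = w].
Proof.
move=> u0 v0 w0 sum1 sumsq.
have le (x : R) : 0 <= x -> x <= 1 -> x ^+ 2 <= x.
  by move=> x0 x1; rewrite expr2 ler_piMl.
have := le u u0; have := le v v0; have := le w w0.
by move=> /(_ ltac:(lra)) ? /(_ ltac:(lra)) ? /(_ ltac:(lra)) ?; split; lra.
Qed.

Lemma expr4_eq_expr2 (x : R) : x ^+ 4 = x ^+ 2 -> x ^+ 3 = x.
Proof.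
move=> x4; apply/eqP; rewrite -subr_eq0 -sqrf_eq0.
have -> : (x ^+ 3 - x) ^+ 2 = (x ^+ 4 - x ^+ 2) * (x ^+ 2 - 1) by ring.
by rewrite x4 subrr mul0r.
Qed.

Lemma expr3_id_norm (x : R) : x ^+ 3 = x -> `|x| = x ^+ 2.
Proof.
move=> x3; have [->|x0] := eqVneq x 0; first by rewrite normr0 expr0n.
have /eqP : x ^+ 2 = 1 by apply: (mulfI x0); rewrite mulr1 -exprS.
by rewrite sqrf_eq1 => /orP[] /eqP ->; rewrite ?normrN normr1 ?sqrrN expr1n.
Qed.

(** The squares of the entries of a row are 0 or 1 and add up to 1, so that a row has a
    single nonzero entry. *)
Lemma signed_row Q p i j : O3 Q -> (forall i j, Q i j ^+ 3 = Q i j) ->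
  i != j -> Q p i * Q p j = 0.
Proof.
move=> hQ cube_id ij.
have row_sq := O3_rows p p hQ; rewrite /delta eqxx in row_sq.
have sq q : (Q p q * Q p q) ^+ 2 = Q p q * Q p q.
  by rewrite -expr2 -exprM (exprS _ 3) cube_id expr2.
have /eqP : (Q p o1 * Q p o2) ^+ 2 + (Q p o1 * Q p o3) ^+ 2 + (Q p o2 * Q p o3) ^+ 2 = 0.
  have : (Q p o1 * Q p o1 + Q p o2 * Q p o2 + Q p o3 * Q p o3) ^+ 2 = 1.
    by rewrite row_sq expr1n.
  have := sq o1; have := sq o2; have := sq o3; move: row_sq.
  by rewrite mulr1n; lra.
rewrite !paddr_eq0 ?addr_ge0 ?sqr_ge0// !sqrf_eq0.
move=> /andP[/andP[/eqP z12 /eqP z13] /eqP z23].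
move: ij; case: (ord3P i) => ->; case: (ord3P j) => ->; rewrite ?eqxx// => _;
  by rewrite // mulrC.
Qed.

(** The condition on the entries says that they are 0, 1 or -1.  For the direct sense the
    diagonal components give, for each column of Q, the sum 1 both for the squares and for
    the fourth powers of the entries. *)
Lemma signed_axes Q : O3 Q -> axes Q = axes 1%:M <-> forall i j, Q i j ^+ 3 = Q i j.
Proof.
move=> hQ; split=> [eqQ p i|cube_id].
  have col := O3_cols i i hQ; rewrite /delta eqxx mulr1n in col.
  have /(congr1 (fun T : tensor4 R => T (i, i, i, i))) := eqQ.
  rewrite axes1E !eqxx ffunE sum3 => /= col4.
  have sq x : (x * x) ^+ 2 = x ^+ 4 :> R by ring.
  have [|||||] := @unit_sum_idempotent (Q o1 i * Q o1 i) (Q o2 i * Q o2 i) (Q o3 i * Q o3 i).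
  1-3: by rewrite -expr2 sqr_ge0.
  - by rewrite col.
  - by rewrite !expr2 !mulrA.
  rewrite !sq -!expr2.
  by case: (ord3P p) => -> h1 h2 h3; exact: expr4_eq_expr2.
apply: tensorP => i j k l; rewrite axes1E ffunE.
have off a b (f : 'I_3 -> R) : a != b -> \sum_p Q p a * Q p b * f p = 0.
  by move=> ab; rewrite big1// => p _; rewrite signed_row// mul0r.
have [<-|ij] /= := eqVneq i j; last first.
  by rewrite -[RHS](off i j (fun p => Q p k * Q p l) ij); apply: eq_bigr => p _; ring.
have [<-|ik] /= := eqVneq i k; last first.
  by rewrite -[RHS](off i k (fun p => Q p i * Q p l) ik); apply: eq_bigr => p _; ring.
have [<-|il] /= := eqVneq i l; last first.
  by rewrite -[RHS](off i l (fun p => Q p i * Q p i) il); apply: eq_bigr => p _; ring.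
have := O3_cols i i hQ; rewrite /delta eqxx => <-.
rewrite -(sum3 (fun p => Q p i * Q p i)); apply: eq_bigr => p _.
transitivity (Q p i ^+ 3 * Q p i); first ring.
by rewrite cube_id.
Qed.

(** The vector of signs of a row lies in the cube, and its image has the sum of the
    absolute values of the row as a coordinate; this sum is at most 1 while the sum of
    squares is 1.  Conversely each row has a single nonzero entry, of modulus 1, so Q and its
    inverse map the cube into itself. *)
Lemma octahedralE Q : SO3 Q -> octahedral Q <-> forall i j, Q i j ^+ 3 = Q i j.
Proof.
move=> hQ; have [hO _] := hQ; split=> [[_ img]|cube_id].
  move=> i j.
  pose x : 'cV[R]_3 := \col_p Num.sg (Q i p).
  have xcube : cube x by move=> p; rewrite mxE normr_sg; case: eqP => _; rewrite ?ler01.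
  have : cube (Q *m x) by rewrite -img; exists x.
  move=> /(_ i); rewrite mxE.
  under eq_bigr do rewrite mxE mulrC -normrEsg.
  rewrite sum3 ger0_norm ?addr_ge0// => sum_le1.
  have := O3_rows i i hO; rewrite /delta eqxx -!expr2.
  rewrite -(real_normK (num_real (Q i o1))) -(real_normK (num_real (Q i o2))).
  rewrite -(real_normK (num_real (Q i o3))) => row_sq.
  have [|||||] := @unit_sum_idempotent `|Q i o1| `|Q i o2| `|Q i o3| => //.
  have fourth p : `|Q i p| ^+ 2 = `|Q i p| -> Q i p ^+ 4 = Q i p ^+ 2.
    by rewrite real_normK ?num_real// => e; rewrite (exprM _ 2 2) e real_normK ?num_real.
  by case: (ord3P j) => -> h1 h2 h3; exact/expr4_eq_expr2/fourth.
split=> //.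
have maps_cube M : O3 M -> (forall i j, M i j ^+ 3 = M i j) ->
    forall x, cube x -> cube (M *m x).
  move=> hM hM3 x cx i; rewrite mxE; apply: le_trans (ler_norm_sum _ _ _) _.
  have <- : \sum_p M i p * M i p = 1 by rewrite sum3 O3_rows// /delta eqxx.
  apply: ler_sum => p _; rewrite normrM -expr2 -expr3_id_norm//.
  by rewrite ler_piMr.
apply/seteqP; split=> [_ [x cx <-]|x cx]; first exact: maps_cube.
exists (Q^T *m x); last by rewrite mulmxA hO mul1mx.
apply: maps_cube cx; first exact: O3_tr.
by move=> i j; rewrite mxE.
Qed.

(** Since [axes] is even in the frame, P may be replaced by a rotation g with the axes as
    columns.  Conjugating by g reduces the stabiliser of [axes g^T] to that of [axes 1],
    which is the octahedral group by [signed_axes] and [octahedralE]. *)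
Lemma cubic_of_axes P E a b c : O3 P -> Ela E -> c != 0 ->
  E = isotropic a b + c *: axes P -> cubic E.
Proof.
move=> hP hE c0 EE; split=> //.
(* In odd dimension det P times P has determinant 1. *)
pose e := \det P.
have e2 : e * e = 1 by have := congr1 determinant hP; rewrite det_mulmx det_tr det1.
pose g := e *: P^T.
have gO : O3 g.
  by rewrite /O3/= /g linearZ/= trmxK -scalemxAl -scalemxAr scalerA e2 scale1r; exact: O3_mulT.
have gS : SO3 g.
  split=> //; rewrite detZ det_tr -/e.
  by transitivity ((e * e) * (e * e)); [ring|rewrite e2 mulr1].
have axes_g : axes P = axes g^T.
  rewrite /g linearZ/= trmxK; apply: tensorP => i j k l; rewrite !ffunE.
  apply: eq_bigr => p _; rewrite !mxE.
  transitivity ((e * e) * (e * e) * (P p i * P p j * P p k * P p l)); last by ring.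
  by rewrite e2 !mul1r.
have {EE}EE : E = isotropic a b + c *: axes g^T by rewrite -axes_g.
have gU : g \in unitmx by apply: (mulmx1_unit gO).1.
have gV : invmx g = g^T by rewrite -[LHS]mulmx1 -gO mulmxA mulVmx// mul1mx.
have stab Q : O3 Q -> star Q E = E <-> axes (g^T *m Q^T *m g) = axes 1%:M.
  move=> hQ; rewrite EE starD starZ star_isotropic// star_axes; split=> [|h].
    move=> /addrI /(scalerI c0)/(congr1 (star g^T)); rewrite !star_axes trmxK => ->.
    by rewrite (O3_mulT gO).
  congr (_ + _ *: _); have := congr1 (star g) h; rewrite !star_axes mul1mx => <-.
  by rewrite -!mulmxA gO mulmx1.
exists g => //; apply/seteqP; split=> [Q [[hQ dQ]]|_ [Q hQ <-]].
  move=> /(stab _ hQ) hax; exists (g^T *m Q *m g); last first.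
    by rewrite gV !mulmxA gO mul1mx -mulmxA gO mulmx1.
  have hS : SO3 (g^T *m Q *m g).
    split; first by apply: O3M => //; apply: O3M => //; exact: O3_tr.
    by rewrite !det_mulmx det_tr dQ gS.2 !mulr1.
  apply/octahedralE => // i j.
  have hT : O3 (g^T *m Q^T *m g).
    by apply: O3M => //; apply: O3M; exact: O3_tr.
  have := (signed_axes hT).1 hax j i.
  have -> : g^T *m Q *m g = (g^T *m Q^T *m g)^T by rewrite !trmx_mul !trmxK mulmxA.
  by have trE (X : 'M[R]_3) : X^T i j = X j i; [rewrite mxE|rewrite trE].
have hSO : SO3 Q by case: hQ.
have [hO dQ] := hSO.
have hO' : O3 (g *m Q *m g^T) by apply: O3M; [exact: O3M|exact: O3_tr].
rewrite gV; split; first by split=> //; rewrite !det_mulmx det_tr dQ gS.2 !mulr1.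
apply/stab => //.
have -> : g^T *m (g *m Q *m g^T)^T *m g = Q^T.
  by rewrite !trmx_mul trmxK !mulmxA (O3_mulT gO) mul1mx -mulmxA (O3_mulT gO) mulmx1.
apply/signed_axes; first exact: O3_tr.
by move=> i j; rewrite mxE; exact: (octahedralE hSO).1.
Qed.

Lemma star_axes_basis P E a b c : O3 P ->
  E = isotropic a b + c *: axes P -> star P E = isotropic a b + c *: axes 1%:M.
Proof. by move=> hP ->; rewrite starD starZ star_isotropic// star_axes hP. Qed.

(** * Harmonic decomposition of tensors with isotropic traces *)

Lemma dev_eq0_scalar (A : 'M[R]_3) : dev A = 0 -> A = (3^-1 * \tr A)%:M.
Proof. by move=> /eqP; rewrite subr_eq0 scalemx1 => /eqP. Qed.

Lemma dev_scalar (x : R) : dev (x%:M : 'M[R]_3) = 0.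
Proof.
rewrite /dev mxtrace_scalar scalemx1.
by have -> : 3^-1 * (x *+ 3) = x; [field|rewrite subrr].
Qed.

Lemma sym_prod11 : sym_prod 1%:M 1%:M = isotropic 3^-1 3^-1 :> tensor4 R.
Proof.
apply: tensorP => i j k l; rewrite /sym_prod total_sym_Ela.
  by rewrite !ffunE !mxE /delta; ring.
by move=> {}i {}j {}k {}l; rewrite !ffunE !mxE (eq_sym j i) (eq_sym l k) (mulrC (k == l)%:R).
Qed.

Lemma sym_prod10 : sym_prod 1%:M 0 = 0 :> tensor4 R.
Proof.
apply: tensorP => i j k l; rewrite /sym_prod /total_sym !ffunE /= big1 ?mulr0// => s _.
by rewrite ffunE [X in _ * X]mxE mulr0.
Qed.

Lemma harm_isotropic_traces E : dev (tr12 E) = 0 -> dev (tr13 E) = 0 ->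
  harm E = total_sym E - (2 * lame_mu E + lame_lambda E) *: isotropic 3^-1 3^-1.
Proof.
move=> h1 h2; rewrite /harm h1 h2 scaler0 addr0 sym_prod10 scaler0 subr0.
by rewrite sym_prod11.
Qed.

Lemma trace13_isotropic lam mu k l :
  \sum_i isotropic lam mu (i, k, i, l) = (lam + 4 * mu) * delta R k l.
Proof.
rewrite sum3 !ffunE /delta.
by case: (ord3P k) => ->; case: (ord3P l) => ->; rewrite !ord3_eq/=; ring.
Qed.

Lemma axes_sym M : tot_sym (axes M).
Proof. by move=> i j k l; rewrite !ffunE; split; apply: eq_bigr => p _; ring. Qed.

Lemma traces_axes P a b c E : O3 P -> E = isotropic a b + c *: axes P ->
  tr12 E = (3 * a + 2 * b + c)%:M /\ tr13 E = (a + 4 * b + c)%:M.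
Proof.
move=> hP EE.
have EE' i j k l : E (i, j, k, l) = isotropic a b (i, j, k, l) + c * axes P (i, j, k, l).
  by rewrite EE ffunE [X in _ + X]ffunE.
split; apply/matrixP => k l; rewrite !mxE; under eq_bigr do rewrite EE'.
  all: rewrite big_split/= -mulr_sumr.
  by rewrite trace12_isotropic trace12_axes// -mulr_natr -/(delta R k l); ring.
have -> : \sum_i axes P (i, k, i, l) = \sum_i axes P (i, i, k, l).
  by apply: eq_bigr => i _; have [_ -> _] := axes_sym P i k i l.
by rewrite trace13_isotropic trace12_axes// -mulr_natr -/(delta R k l); ring.
Qed.

(** The difference [isotropic (c / 5) (c / 5)] between c [axes P] and its harmonic part
    goes into the Lame coefficients. *)
Lemma harm_axes P a b c E : O3 P -> Ela E -> E = isotropic a b + c *: axes P ->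
  [/\ dev (tr12 E) = 0, dev (tr13 E) = 0 & harm E = c *: cubic_harmonic P].
Proof.
move=> hP hE EE; have [t12 t13] := traces_axes hP EE.
have d12 : dev (tr12 E) = 0 by rewrite t12 dev_scalar.
have d13 : dev (tr13 E) = 0 by rewrite t13 dev_scalar.
split=> //; rewrite harm_isotropic_traces// /lame_mu /lame_lambda t12 t13 !mxtrace_scalar.
apply: tensorP => i j k l.
have EE' i' j' k' l' :
    E (i', j', k', l') = isotropic a b (i', j', k', l') + c * axes P (i', j', k', l').
  by rewrite EE ffunE [X in _ + X]ffunE.
rewrite ffunE total_sym_Ela// !EE'.
have -> : axes P (i, k, j, l) = axes P (i, j, k, l) by have [_ -> _] := axes_sym P i k j l.
have -> : axes P (i, l, j, k) = axes P (i, j, k, l).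
  by have [_ -> _] := axes_sym P i l j k; have [_ _ ->] := axes_sym P i j l k.
rewrite !ffunE.
rewrite /delta (eq_sym k j) (eq_sym l j) (eq_sym l k).
by rewrite !scaleE; field.
Qed.

Lemma harm_sym E : Ela E -> dev (tr12 E) = 0 -> dev (tr13 E) = 0 -> tot_sym (harm E).
Proof.
move=> hE h12 h13; rewrite harm_isotropic_traces// -scaleNr.
have [s1 s2 s3] := Ela_swaps hE.
apply: tot_symD; last first.
  apply: tot_symZ => i j k l; rewrite !ffunE /delta (eq_sym j i) (eq_sym k j) (eq_sym l k).
  by split; ring.
move=> i j k l; rewrite !total_sym_Ela//; split; congr (_ * _).
- by rewrite (s1 j i k l) (s3 j k i l) (s3 j l i k); ring.
- by rewrite (s2 i l k j); ring.
- by rewrite (s2 i j l k); ring.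
Qed.

Lemma isotropic_traces E : dev (tr12 E) = 0 -> dev (tr13 E) = 0 -> exists d v,
  [/\ forall k l, \sum_i E (i, i, k, l) = d * delta R k l,
      forall k l, \sum_i E (i, k, i, l) = v * delta R k l,
      lame_lambda E = (2 * d - v) / 5 & lame_mu E = (3 * v - d) / 10].
Proof.
move=> /dev_eq0_scalar t12 /dev_eq0_scalar t13.
exists (3^-1 * \tr (tr12 E)), (3^-1 * \tr (tr13 E)); split.
- move=> k l; transitivity (tr12 E k l); first by rewrite mxE.
  by rewrite [in LHS]t12 mxE mulr_natr.
- move=> k l; transitivity (tr13 E k l); first by rewrite mxE.
  by rewrite [in LHS]t13 mxE mulr_natr.
- by rewrite /lame_lambda; field.
- by rewrite /lame_mu; field.
Qed.

Lemma harm_traceless E : Ela E -> dev (tr12 E) = 0 -> dev (tr13 E) = 0 ->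
  traceless (harm E).
Proof.
move=> hE h12 h13 k l; rewrite harm_isotropic_traces//.
have [d [v [hd hv -> ->]]] := isotropic_traces h12 h13.
under eq_bigr do rewrite ffunE [X in _ + X]ffunE total_sym_Ela// [X in - X]ffunE.
rewrite big_split/= sumrN -mulr_sumr -scaler_sumr trace12_isotropic !big_split/= hd hv.
have -> : \sum_i E (i, l, i, k) = v * delta R k l by rewrite hv /delta eq_sym.
by rewrite scaleE; field.
Qed.

(** In dimension 3 the part of E that total symmetrisation loses has six components, and
    they are determined by the difference of the two traces: for instance
    E1122 - E1212 is half of the sum of the diagonal entries 11 and 22 minus the entry 33 of
    that difference. *)
Lemma harm_decomposition E : Ela E -> dev (tr12 E) = 0 -> dev (tr13 E) = 0 ->
  E = isotropic (lame_lambda E) (lame_mu E) + harm E.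
Proof.
move=> hE h12 h13; rewrite harm_isotropic_traces//.
have [d [v [hd hv -> ->]]] := isotropic_traces h12 h13.
have [s1 s2 s3] := Ela_swaps hE.
(* The component (k, l) of the difference of the two traces: the terms with i = k or i = l
   cancel. *)
have sub k l : \sum_i E (i, k, i, l) = \sum_i E (i, i, k, l) - (d - v) * delta R k l.
  by rewrite hd hv; ring.
move: (sub o1 o1) (sub o1 o2) (sub o1 o3) (sub o2 o2) (sub o2 o3) (sub o3 o3).
rewrite !sum3 /delta !ord3_eq/=; sort_Ela s1 s2 s3.
move=> r11 r12 r13 r22 r23 r33.
have e1212 : E (o1, o2, o1, o2) = E (o1, o1, o2, o2) - (d - v) / 2 by lra.
have e1313 : E (o1, o3, o1, o3) = E (o1, o1, o3, o3) - (d - v) / 2 by lra.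
have e2323 : E (o2, o3, o2, o3) = E (o2, o2, o3, o3) - (d - v) / 2 by lra.
have e1213 : E (o1, o2, o1, o3) = E (o1, o1, o2, o3) by lra.
have e1223 : E (o1, o2, o2, o3) = E (o2, o2, o1, o3) by lra.
have e1323 : E (o1, o3, o2, o3) = E (o3, o3, o1, o2) by lra.
(* Antisymmetric in j and k and in i and l, like a curvature tensor: six independent
   components. *)
have curvature i j k l : E (i, j, k, l) - E (i, k, j, l) =
    (d - v) / 2 * (delta R i j * delta R k l - delta R i k * delta R j l).
  clear -s1 s2 s3 e1212 e1313 e2323 e1213 e1223 e1323.
  have [jk|jk] := eqVneq j k; first by rewrite jk; ring.
  have [il|il] := eqVneq i l.
    by rewrite il (s1 l j) (s3 j l) (s1 k l) /delta (eq_sym l k) (eq_sym l j); ring.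
  move: il jk; rewrite /delta.
  case: (ord3P i) => ->; case: (ord3P l) => ->; rewrite ?eqxx// => _;
  case: (ord3P j) => ->; case: (ord3P k) => ->; rewrite ?eqxx// => _;
    rewrite !ord3_eq/=; sort_Ela s1 s2 s3;
    by rewrite ?(e1212, e1313, e2323, e1213, e1223, e1323); field.
apply: tensorP => i j k l; rewrite ffunE [X in _ + X]ffunE total_sym_Ela//.
have := curvature i j k l; have := curvature i j l k.
by rewrite (s2 i j l k) !ffunE !scaleE /delta (eq_sym l k); lra.
Qed.

Lemma d2_cubic_harmonic P : O3 P -> d2 (cubic_harmonic P) = (2 / 5)%:M.
Proof.
move=> hP; have -> : cubic_harmonic P = star P^T (cubic_harmonic 1%:M).
  by rewrite star_cubic_harmonic ?trmxK ?mul1mx//; exact: O3_tr.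
rewrite d2_star; [|exact: O3_tr|exact: cubic_harmonic_sym].
have -> : d2 (cubic_harmonic 1%:M) = (2 / 5)%:M :> 'M[R]_3.
  have ch i j k l : cubic_harmonic 1%:M (i, j, k, l) =
     (if [&& i == j, i == k & i == l] then 1 else 0) -
      ((if (i == j) && (k == l) then 5^-1 else 0) + (if (i == k) && (j == l) then 5^-1 else 0)
      + (if (i == l) && (j == k) then 5^-1 else 0)) :> R.
    rewrite ffunE axes1E !ffunE /delta.
    by do 6!case: (_ == _) => /=; ring.
  apply/matrixP => i j; rewrite d2E; last exact: cubic_harmonic_sym.
  rewrite !ch mxE.
  case: (ord3P i) => ->; case: (ord3P j) => ->;
    by rewrite !ord3_eq/=; field.
by rewrite mul_mx_scalar -scalemxAl trmxK O3_mulT// scalemx1.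
Qed.

(** * Cubic bases and cubic pairs *)

(** When the four indices do not match in pairs, each product of two Kronecker symbols
    vanishes. *)
Lemma unpaired_isotropic_axes (a b : R) i j k l :
  ~~ [|| (i == j) && (k == l), (i == k) && (j == l) | (i == l) && (j == k)] ->
  isotropic a b (i, j, k, l) = 0 /\ axes (1%:M : 'M[R]_3) (i, j, k, l) = 0.
Proof.
rewrite !negb_or => /and3P[/negbTE h1 /negbTE h2 /negbTE h3].
rewrite axes1E ffunE /delta -!natrM !mulnb h1 h2 h3; split=> /=; first by ring.
have [/andP[/andP[/eqP ij /eqP ik] /eqP il]|_//] := boolP ((i == j) && (i == k) && (i == l)).
by move: h1; rewrite -ij -ik -il !eqxx.
Qed.

Lemma cubic_components_axes E : Ela E -> cubic_components E ->
  exists a b c, c != 0 /\ E = isotropic a b + c *: axes 1%:M.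
Proof.
move=> hE [[e1 e2] [e3 e4] [e5 e6] zero c0].
exists (E (o1, o1, o2, o2)), (E (o1, o2, o1, o2)).
exists (E (o1, o1, o1, o1) - E (o1, o1, o2, o2) - 2 * E (o1, o2, o1, o2)); split=> //.
have [s1 s2 s3] := Ela_swaps hE.
apply: tensorP => i j k l.
rewrite ffunE [X in _ + X]ffunE scaleE.
have [paired|unpaired] := boolP [|| (i == j) && (k == l), (i == k) && (j == l)
             | (i == l) && (j == k)]; last first.
  have [-> ->] := unpaired_isotropic_axes (E (o1, o1, o2, o2)) (E (o1, o2, o1, o2)) unpaired.
  by rewrite zero// mulr0 addr0.
rewrite axes1E ffunE /delta.
move: paired.
case: (ord3P i) => ->; case: (ord3P j) => ->; case: (ord3P k) => ->; case: (ord3P l) => ->.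
all: rewrite !ord3_eq//= => _.
all: sort_Ela s1 s2 s3.
all: rewrite -?e6 -?e5 -?e4 -?e3 -?e2 -?e1; ring.
Qed.

Lemma cubic_components_isotropic_axes (a b c : R) :
  c != 0 -> cubic_components (isotropic a b + c *: axes 1%:M).
Proof.
move=> c0.
have comp i j k l : (isotropic a b + c *: axes 1%:M) (i, j, k, l) =
    a * (delta R i j * delta R k l) +
    b * (delta R i k * delta R j l + delta R i l * delta R j k) +
    c * ((i == j) && (i == k) && (i == l))%:R.
  by rewrite ffunE [X in _ + X]ffunE axes1E ffunE scaleE.
rewrite /cubic_components !comp /delta !ord3_eq/=; split.
- by split; ring.
- by split; ring.
- by split; ring.
- move=> i j k l unpaired; rewrite ffunE [X in _ + X]ffunE scaleE.
  by have [-> ->] := unpaired_isotropic_axes a b unpaired; rewrite mulr0 addr0.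
- by apply: contra_neq c0 => e; rewrite -e; ring.
Qed.

Lemma cubic_pair_sym E F : cubic_pair E F -> cubic_pair F E.
Proof. by move=> [hE hF [P [pE pF]]]; split=> //; exists P. Qed.

Lemma cubic_pair_axes P E F a b c a' b' c' : O3 P -> Ela E -> Ela F ->
  c != 0 -> c' != 0 -> E = isotropic a b + c *: axes P -> F = isotropic a' b' + c' *: axes P ->
  cubic_pair E F.
Proof.
move=> hP hE hF c0 c0' EE FF; split; [exact: cubic_of_axes EE|exact: cubic_of_axes FF|].
exists P; split; split=> //.
  by rewrite (star_axes_basis hP EE); exact: cubic_components_isotropic_axes.
by rewrite (star_axes_basis hP FF); exact: cubic_components_isotropic_axes.
Qed.

(** The components in the frame P give the form with the standard axes; going back
    turns [axes 1] into [axes P]. *)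
Lemma cubic_basis_axes E P : Ela E -> cubic_basis E P ->
  exists a b c, c != 0 /\ E = isotropic a b + c *: axes P.
Proof.
move=> hE [hP hc]; have [a [b [c [c0 EE]]]] := cubic_components_axes (star_Ela P hE) hc.
exists a, b, c; split=> //; rewrite -[LHS](starK E hP) EE starD starZ star_isotropic.
  by rewrite star_axes trmxK mul1mx.
exact: O3_tr.
Qed.

Lemma d2Z (c : R) T : d2 (c *: T) = c ^+ 2 *: d2 T.
Proof.
apply/matrixP => i j; rewrite !mxE; do 3!(rewrite mulr_sumr; apply: eq_bigr => ? _).
by rewrite !ffunE; exact: mulrACA.
Qed.

(** The classification applied to the harmonic part of E yields axes that, by
    proportionality, also serve for F. *)
Lemma cubic_pair_of_harmonic_parts E F (k : R) : Ela E -> Ela F ->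
  dev (tr12 E) = 0 -> dev (tr13 E) = 0 -> dev (tr12 F) = 0 -> dev (tr13 F) = 0 ->
  dev (d2 (harm E)) = 0 -> harm E = k *: harm F -> k *: harm F <> 0 -> cubic_pair E F.
Proof.
move=> hE hF E12 E13 F12 F13 d2H HK KN0.
have [P hP [c Hc]] := isotropic_d2_cubic_harmonic (harm_sym hE E12 E13)
  (harm_traceless hE E12 E13) (dev_eq0_scalar d2H).
have c0 : c != 0.
  by apply/eqP => c0; apply: KN0; rewrite -HK Hc c0 scale0r.
have k0 : k != 0.
  by apply/eqP => k0; apply: KN0; rewrite k0 scale0r.
have Kc : harm F = (k^-1 * c) *: cubic_harmonic P.
  by rewrite -scalerA -Hc HK scalerA mulVf// scale1r.
have isotropicD (a b x : R) : isotropic a b + x *: cubic_harmonic P =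
    isotropic (a - x / 5) (b - x / 5) + x *: axes P.
  apply: tensorP => i j p q.
  by rewrite !ffunE !scaleE; ring.
have decE := harm_decomposition hE E12 E13; rewrite Hc isotropicD in decE.
have decF := harm_decomposition hF F12 F13; rewrite Kc isotropicD in decF.
have c0' : k^-1 * c != 0 by rewrite mulf_neq0// invr_eq0.
exact: cubic_pair_axes hP hE hF c0 c0' decE decF.
Qed.

(** Its quadratic covariant is 2/5 times the identity. *)
Lemma cubic_harmonic_neq0 P : O3 P -> cubic_harmonic P <> 0.
Proof.
move=> hP h0; have := d2_cubic_harmonic hP.
rewrite h0 => /matrixP/(_ o1 o1); rewrite !mxE eqxx big1 => [|p _].
  by move=> /eqP; rewrite eq_sym mulr1n mulf_eq0 invr_eq0 !pnatr_eq0.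
by rewrite big1// => q _; rewrite big1// => r _; rewrite !ffunE mul0r.
Qed.

End CubicTensors.

Theorem theorem4p1 (R : realType) (E F : tensor4 R)
    (hE : Ela E) (hF : Ela F) :
  let H := harm E in
  let K := harm F in
  cubic_pair E F <->
  [/\ dev (tr12 E) = 0, dev (tr13 E) = 0, dev (tr12 F) = 0 & dev (tr13 F) = 0]
  /\
  ((dev (d2 H) = 0 /\ exists k : R, H = k *: K /\ k *: K <> 0) \/
   (dev (d2 K) = 0 /\ exists k : R, K = k *: H /\ k *: H <> 0)).
Proof.
move=> H K; split=> [[_ _ [P [pE pF]]]|[[E12 E13 F12 F13]]].
  have hP := pE.1.
  have [a [b [c [c0 EE]]]] := cubic_basis_axes hE pE.
  have [a' [b' [c' [c0' FF]]]] := cubic_basis_axes hF pF.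
  have [E12 E13 HE] := harm_axes hP hE EE.
  have [F12 F13 HF] := harm_axes hP hF FF.
  split; first by split.
  left; rewrite /H /K HE HF; split.
    by rewrite d2Z d2_cubic_harmonic// scale_scalar_mx dev_scalar.
  exists (c / c'); rewrite scalerA divfK//; split=> //.
  move=> /eqP; rewrite scaler_eq0 (negbTE c0) => /eqP; exact: cubic_harmonic_neq0.
case=> [[d2H [k [HK n0]]]|[d2K [k [KH n0]]]].
  exact: cubic_pair_of_harmonic_parts HK n0.
by apply: cubic_pair_sym; exact: cubic_pair_of_harmonic_parts KH n0.
Qed.
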